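(* Let $n\geq 3$ and let $\mathcal{M}:=\{(t,f(t)) : t\in[-1,1]\}\subset\mathbb{R}^n$, where $f=(f_2,\dots,f_n)\colon[-1,1]\to\mathbb{R}^{n-1}$ and each $f_i$ is the restriction of a $C^\infty$ function defined on an open neighbourhood $U$ of $[-2,2]$. Put $\gamma(t):=(t,f(t))$ and suppose $$\det\begin{bmatrix}\gamma^{(1)}(t)&\gamma^{(2)}(t)&\cdots&\gamma^{(n)}(t)\end{bmatrix}\neq 0\qquad\text{for all } t\in U.$$ For $q\in\mathbb{N}$ and $0<\delta<1/2$ let $N_{\mathcal{M}}(q,\delta)$ be the cardinality of $\{b\in\mathbb{Z}^n:\mathrm{dist}(b/q,\mathcal{M})<\delta/q\}$, where $\mathrm{dist}$ is Euclidean distance. Define $$\Theta(n):=\begin{cases}\dfrac{n^2+4}{n(n+4)} & n \text{ even},\\[6pt] \dfrac{n^2+3}{n(n+4)-1} & n\text{ odd}.\end{cases}$$ Let $\nu>0$. Then for all $q\in\mathbb{N}$ and all $\delta\in(0,1/4)$, $$N_{\mathcal{M}}(q,\delta)\leq C\big(\delta^{n-1}q+q^{\Theta(n)+\nu}\big),$$ where $C>0$ depends only on $\mathcal{M}$ (and $n$) and $\nu$. Further, there is $q_0=q_0(\nu,\mathcal{M})$ and $c=c(\nu,\mathcal{M})>0$ such that for all $q\geq q_0$ and all $\delta\in(0,1/4)$ with $$\delta\geq\begin{cases} q^{-\frac{4}{n(n+4)}+\nu} & n\text{ even},\\ q^{-\frac{4}{n(n+4)-1}+\nu} & n\text{ odd},\end{cases}$$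 we have $N_{\mathcal{M}}(q,\delta)\geq c\,\delta^{n-1}q$.
   Context: $\gamma^{(r)}$ denotes the $r$-th derivative of $\gamma$. *)

(* Defs.v *)
From HB Require Import structures.
From mathcomp Require Import all_boot all_order all_algebra.
From mathcomp Require Import all_classical all_reals all_analysis.
From mathcomp Require Import finmap.
Set Implicit Arguments. Unset Strict Implicit. Unset Printing Implicit Defensive.
Import Order.TTheory GRing.Theory Num.Theory.
Import numFieldNormedType.Exports.
Local Open Scope classical_set_scope.
Local Open Scope ring_scope.
Local Open Scope fset_scope.

Section Defs.
Variable R : realType.

(* Euclidean norm on R^n (the library's norm on 'rV is the sup norm). *)
Definition eucl_norm (n : nat) (v : 'rV[R]_n) : R :=
  Num.sqrt (\sum_(i < n) v ord0 i ^+ 2).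

Definition eucl_dist (n : nat) (x : 'rV[R]_n) (A : set 'rV[R]_n) : R :=
  inf [set eucl_norm (x - y) | y in A].

(* gamma(t) = (t, f_2(t), ..., f_n(t)); coordinate 0 is t, coordinate i >= 1
   is f i t (the value f ord0 is never used). *)
Definition gamma (n : nat) (f : 'I_n -> R -> R) (i : 'I_n) : R -> R :=
  if (i : nat) == 0%N then (fun t => t) else f i.

Definition gammav (n : nat) (f : 'I_n -> R -> R) (t : R) : 'rV[R]_n :=
  \row_(i < n) gamma f i t.

Definition curveM (n : nat) (f : 'I_n -> R -> R) : set 'rV[R]_n :=
  [set gammav f t | t in `[(-1)%R, 1%R]].

Definition wronski (n : nat) (f : 'I_n -> R -> R) (t : R) : 'M[R]_n :=
  \matrix_(i < n, k < n) derive1n k.+1 (gamma f i) t.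

Definition NM (n : nat) (f : 'I_n -> R -> R) (q : nat) (delta : R) : nat :=
  #|` fset_set [set b : 'rV[int]_n |
      eucl_dist ((q%:R)^-1 *: map_mx (fun z : int => z%:~R : R) b) (curveM f)
        < delta / q%:R] |.

Definition Theta (n : nat) : R :=
  if odd n then ((n ^ 2 + 3)%:R / ((n * (n + 4))%:R - 1))
  else ((n ^ 2 + 4)%:R / (n * (n + 4))%:R).

Definition lower_exp (n : nat) : R :=
  if odd n then 4 / ((n * (n + 4))%:R - 1) else 4 / (n * (n + 4))%:R.

End Defs.

(* Main.v *)
Require Import Defs.
From HB Require Import structures.
From mathcomp Require Import all_boot all_order all_algebra.
From mathcomp Require Import all_classical all_reals all_analysis.
From mathcomp Require Import perm finmap.
From mathcomp Require Import ring lra zify.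
Import Order.TTheory GRing.Theory Num.Theory.
Import numFieldNormedType.Exports.
Local Open Scope classical_set_scope.
Local Open Scope ring_scope.
Set Implicit Arguments. Unset Strict Implicit. Unset Printing Implicit Defensive.

(** Write [d = n - 1] and [x_a = q f(a/q)] for [|a| <= q]; up to constants, [N(q, delta)]
    counts the [a] for which [x_a] is within [delta] of the integer lattice of [R^d].
    Detecting this with trigonometric polynomials of degree [L ~ 1/delta] (a Dirichlet
    kernel from above, and from below a tent kernel times a factor which is negative away
    from the lattice) reduces both bounds to showing that the sum over [0 < |j| <= L]
    of [|sum_a cos(2 pi j.x_a)|] is at most a small multiple of [q].

    Cut the range of [a] into about [L] blocks, on each of which all derivatives of the
    phase [phi_j = j.f] are constant up to a small error. As the Wronskian does not vanish,
    some [phi_j^(k)], [2 <= k <= n], is bounded below on the block, and for the first such [k] the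
    discrete van der Corput estimate bounds the block by [q (q |phi_j^(k)|)^(-1/k)]. The
    map from [j] to the derivatives of [phi_j] of orders [2, ..., n] is boundedly many-to-one
    modulo rounding, hence this [k] contributes at most [q L^(n-k+2) (q L)^(-1/k)] in total.
    This is small as soon as [L^(k(n-k+2)-1)] is a small multiple of [q], and the largest
    value of [k(n-k+2)-1] is the reciprocal of [lower_exp]. For smaller [delta], the upper
    bound follows by monotonicity in [delta]. *)

(** * Exponential sums *)

(** Both kernels enter as squared moduli of trigonometric sums over a box of frequencies [k], so the
    vectors j are differences [k - l]. Summed over a, the diagonal gives the main term, and Schur's
    test controls the rest by the row sums over [l != k]. These do not involve the coefficients, so
    one estimate serves both kernels.

    The obstacle is that the phases have derivatives of size up to L. The first derivative is
    reduced modulo 1, which works only where it is nearly constant, and this forces blocks of length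
    about q/L. Using the worst order of derivative for every j would be too weak; the saving comes
    from averaging over j. If k is the first order whose derivative is not small, the k - 2 earlier
    ones fall in boundedly many cells, the k-th contributes the sum of m^(-1/k) over m up to about
    L, and the n - k later ones are free.

    The curve is used beyond [-1, 1] because differences taken near the last point reach a few steps
    past it. *)

Section Trigonometry.
Variable R : realType.
Implicit Types (x y : R).

Lemma mul_cos_le_sin x : 0 <= x <= pi -> x * cos x <= sin x.
Proof.
move=> /andP[x0 xpi].
have H : forall y, is_derive y 1 (fun z : R => sin z - z * cos z) (y * sin y).
  by move=> y; apply: is_derive_eq; rewrite /GRing.scale /=; ring.
have [c cx] : exists2 c, c \in `[0, x]%R &
   (sin x - x * cos x) - (sin 0 - 0 * cos 0) = c * sin c * (x - 0).
  apply: (@MVT_segment R (fun z : R => sin z - z * cos z) (fun y => y * sin y)) => //.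
  apply: derivable_within_continuous => y _.
  by have [] := H y.
rewrite sin0 mul0r subr0 !subr0 => E.
move: cx; rewrite in_itv /= => /andP[c0 cx].
rewrite -subr_ge0 E mulr_ge0 // mulr_ge0 // sin_ge0_pi //.
by rewrite c0 (le_trans cx).
Qed.

Lemma cos_piquarter_sqr : cos (pi / 4) ^+ 2 = 1 / 2 :> R.
Proof.
have := @cos_mulr2n R (pi / 4).
have -> : pi / 4 *+ 2 = pi / 2 :> R by field.
rewrite cos_pihalf => /esym/eqP; rewrite subr_eq0 => /eqP; lra.
Qed.

(** Halve the angle: with y = pi d / 2, sin 2y = 2 sin y cos y >= 2 y cos^2 y, and cos^2 y >= 1/8
    because 2y <= 3 pi / 4. The limit 3/4 is what [block_bound] leaves of a first difference: 1/2
    from rounding and 1/4 from variation. *)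
Lemma sin_pi_mul_ge (d : R) : 0 <= d <= 3 / 4 -> d / 4 <= sin (pi * d).
Proof.
move=> /andP[d0 d1]; have p2 := pi_ge2 R.
set y := pi * d / 2.
have yle : y <= pi * (3 / 8) by rewrite /y; nra.
have y0 : 0 <= y by rewrite /y; nra.
have -> : pi * d = y *+ 2 by rewrite /y; field.
rewrite sin_mulr2n.
have h1 : y * cos y <= sin y by apply: mul_cos_le_sin; rewrite y0; lra.
have c0 : 0 <= cos y by apply: cos_ge0_pihalf; apply/andP; split; lra.
have h8 : 1 / 8 <= cos y ^+ 2.
  have E : cos (pi * (3 / 4)) = - cos (pi / 4) :> R.
    have -> : pi * (3 / 4) = - (pi / 4) + pi :> R by field.
    by rewrite cosDpi cosN.
  have le2 : cos (pi * (3 / 4)) <= cos (y *+ 2).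
    have [->|ne] := eqVneq (y *+ 2) (pi * (3 / 4)) => //.
    apply: ltW; rewrite ltr_cos ?in_itv /=.
    - rewrite lt_neqAle ne /=; lra.
    - by apply/andP; split; lra.
    - by apply/andP; split; lra.
  have q4 := cos_piquarter_sqr; rewrite E cos_mulr2n in le2.
  have : cos (pi / 4) <= 3 / 4 :> R by nra.
  lra.
have yd : d <= y by rewrite /y; nra.
rewrite mulr2n; nra.
Qed.

Lemma cot_le (x y : R) : 0 < x -> x <= y -> y < pi ->
  cos y / sin y <= cos x / sin x.
Proof.
move=> x0 xy yp.
have sx : 0 < sin x by apply: sin_gt0_pi; lra.
have sy : 0 < sin y by apply: sin_gt0_pi; lra.
rewrite ler_pdivrMr // mulrAC ler_pdivlMr //.
have : 0 <= sin (y - x) by apply: sin_ge0_pi; lra.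
rewrite sinB; lra.
Qed.

Lemma sin_norm_le x : `|sin x| <= `|x|.
Proof.
wlog x0 : x / 0 <= x => [H|].
  have [/H//|/ltW x0] := leP 0 x.
  by rewrite -normrN -sinN -(normrN x); apply: H; rewrite oppr_ge0.
have [c _] : exists2 c, c \in `[0, x]%R & sin x - sin 0 = cos c * (x - 0).
  apply: (@MVT_segment R sin cos) => //.
  by apply: derivable_within_continuous => y _; exact: derivable_sin.
rewrite sin0 !subr0 => ->; rewrite normrM.
by rewrite ler_piMl // cos_max.
Qed.

Lemma one_sub_cos x : 1 - cos x = 2 * sin (x / 2) ^+ 2.
Proof.
have {1}-> : x = x / 2 *+ 2 by field.
rewrite cos_mulr2n; have := cos2Dsin2 (x / 2); lra.
Qed.

Lemma cos_ge_half x : `|x| <= 1 -> 1 / 2 <= cos x.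
Proof.
move=> x1; have := one_sub_cos x; have := sin_norm_le (x / 2).
rewrite normrM (@ger0_norm _ 2^-1) // => h e.
have : sin (x / 2) ^+ 2 <= 1 / 4.
  rewrite -real_normK ?num_real //; have := normr_ge0 (sin (x / 2)); nra.
lra.
Qed.

(** Turns a small value of the periodic deviation into closeness to an integer. As 1 - cos(2 pi y) =
    2 sin^2(pi y), halving the angle to z = pi y / 2 gives sin 2z >= 2 z cos^2 z >= z >= y. *)
Lemma one_sub_cos_2pi_ge y : `|y| <= 1 / 2 -> 2 * y ^+ 2 <= 1 - cos (2 * pi * y).
Proof.
wlog y0 : y / 0 <= y => [H|].
  have [/H//|/ltW y0] := leP 0 y.
  rewrite -normrN => /H; rewrite oppr_ge0 => /(_ y0).
  by rewrite mulrN cosN sqrrN.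
rewrite ger0_norm // => y1; have p2 := pi_ge2 R.
rewrite one_sub_cos; set z := pi * y / 2.
have -> : 2 * pi * y / 2 = z *+ 2 by rewrite /z; field.
rewrite sin_mulr2n.
have z0 : 0 <= z by rewrite /z; nra.
have z1 : z <= pi / 4 by rewrite /z; nra.
have h1 : z * cos z <= sin z by apply: mul_cos_le_sin; rewrite z0; lra.
have c0 : 0 <= cos z by apply: cos_ge0_pihalf; apply/andP; split; lra.
have h8 : 1 / 2 <= cos z ^+ 2.
  rewrite -cos_piquarter_sqr.
  have c4 : cos (pi / 4) <= cos z.
    have [->|ne] := eqVneq z (pi / 4) => //.
    apply: ltW; rewrite ltr_cos ?in_itv /=.
    - by rewrite lt_neqAle ne.
    - by apply/andP; split; lra.
    - by apply/andP; split; lra.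
  have : 0 <= cos (pi / 4) :> R by apply: cos_ge0_pihalf; apply/andP; split; lra.
  nra.
have yz : y <= z by rewrite /z; nra.
have h : y / 2 <= cos z * sin z by nra.
rewrite mulr2n; nra.
Qed.

Lemma cosD2piz x (m : int) : cos (x + 2 * pi * m%:~R) = cos x.
Proof.
have H : forall n x, cos (x + 2 * pi * n%:R) = cos x.
  move=> n z; have -> : 2 * pi * n%:R = pi *+ 2 *+ n :> R.
    by rewrite -[RHS]mulr_natr -(mulr_natr pi 2); ring.
  exact: periodicn (@cosD2pi R) n z.
case: m => n; first exact: H.
rewrite -[in RHS](subrK (2 * pi * n.+1%:R) x) H NegzE; congr cos.
by rewrite mulrNz mulrN.
Qed.

End Trigonometry.

(** * Kusmin-Landau and van der Corput estimates for real sequences *)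

Section ExponentialSums.
Variable R : realType.
Implicit Types (u v c s : nat -> R) (N : nat).

Definition fdiff u : nat -> R := fun a => u a.+1 - u a.

(** Summation by parts: after removing the boundary term [c N * s N.+1], what remains is the other
    boundary term plus the total variation [c 0 - c N] of the weights. *)
Lemma abel_bound c s (M : R) N : 0 <= M -> (forall a, `|s a| <= 1) ->
  (forall a, (a < N)%N -> `|c a| <= M) ->
  (forall a, (a.+1 < N)%N -> c a.+1 <= c a) ->
  `|\sum_(0 <= a < N) c a * (s a.+1 - s a)| <= 4 * M.
Proof.
move=> M0 s1; case: N => [|N] cM mc.
  by rewrite big_nil normr0 mulr_ge0.
suff H : `|\sum_(0 <= a < N.+1) c a * (s a.+1 - s a) - c N * s N.+1|
         <= M + (c 0%N - c N).
  have cN : `|c N * s N.+1| <= M.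
    by rewrite normrM -[M]mulr1; apply: ler_pM => //; exact: cM.
  have := cM N (ltnSn _); have := cM 0%N (ltn0Sn _).
  move: H cN; rewrite !ler_norml => /andP[? ?] /andP[? ?] /andP[? ?] /andP[? ?].
  by apply/andP; split; lra.
elim: N mc cM => [|N IH] mc cM.
  rewrite big_nat1 subrr addr0 mulrBr addrAC subrr add0r normrN normrM.
  by rewrite -[M]mulr1; apply: ler_pM => //; exact: cM.
have {}IH := IH (fun a h => mc a (ltnW h)) (fun a h => cM a (ltnW h)).
rewrite big_nat_recr //=; set S := \sum_(_ <= _ < _) _ in IH *.
have -> : S + c N.+1 * (s N.+2 - s N.+1) - c N.+1 * s N.+2 =
  (S - c N * s N.+1) + (c N - c N.+1) * s N.+1 by ring.
apply: (le_trans (ler_normD _ _)).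
have cc := mc N (ltnSn _).
have : `|(c N - c N.+1) * s N.+1| <= c N - c N.+1.
  by rewrite normrM ger0_norm ?subr_ge0 // ler_piMr // subr_ge0.
lra.
Qed.

(** The real part of e^(ix) = (e^(ix) - e^(iy)) / (1 - e^(i(y-x))), since 1 / (1 - e^(2id)) = (1 + i
    cot d) / 2. *)
Lemma cos_eq_cot (x y : R) : sin ((y - x) / 2) != 0 ->
  cos x = (cos x - cos y) / 2
    + cos ((y - x) / 2) / sin ((y - x) / 2) * (sin y - sin x) / 2.
Proof.
set d := (y - x) / 2; set m := (x + y) / 2 => sd.
have -> : x = m - d by rewrite /m /d; field.
have -> : y = m + d by rewrite /m /d; field.
rewrite cosB cosD sinB sinD; field: (cos2Dsin2 d).
exact: sd.
Qed.

(** By [cos_eq_cot] each cosine is half a telescoping increment plus half an increment of the sine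
    weighted by cot(pi * [fdiff u a]). These weights are monotone and at most 4 / [lam] in modulus,
    so Abel summation applies. *)
Lemma kusmin_landau u N (lam : R) : 0 < lam ->
  (forall a, (a < N)%N -> lam <= fdiff u a <= 3 / 4) ->
  (forall a, (a.+1 < N)%N -> fdiff u a <= fdiff u a.+1) \/
  (forall a, (a.+1 < N)%N -> fdiff u a.+1 <= fdiff u a) ->
  `|\sum_(0 <= a < N) cos (2 * pi * u a)| <= 1 + 8 / lam.
Proof.
move=> l0 H mono; have p2 := pi_ge2 R.
pose x a := pi * fdiff u a.
pose c a := cos (x a) / sin (x a); pose s a := sin (2 * pi * u a).
have sx a : (a < N)%N -> lam / 4 <= sin (x a).
  move=> /H /andP[h1 h2]; apply: (le_trans _ (sin_pi_mul_ge _)); lra.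
have s0 a : (a < N)%N -> 0 < sin (x a).
  by move=> /sx; apply: lt_le_trans; rewrite divr_gt0.
have -> : \sum_(0 <= a < N) cos (2 * pi * u a) =
  (\sum_(0 <= a < N) (cos (2 * pi * u a.+1) - cos (2 * pi * u a))) * (- (1 / 2))
  + (\sum_(0 <= a < N) c a * (s a.+1 - s a)) * (1 / 2).
  rewrite !mulr_suml -big_split /=; apply: eq_big_nat => a /andP[_ aN].
  have E : (2 * pi * u a.+1 - 2 * pi * u a) / 2 = x a.
    by rewrite /x /fdiff; field.
  rewrite {1}(@cos_eq_cot (2 * pi * u a) (2 * pi * u a.+1)) E /c /s; first by field; rewrite gt_eqF ?s0.
  by rewrite gt_eqF ?s0.
have tele : `|\sum_(0 <= a < N) (cos (2 * pi * u a.+1) - cos (2 * pi * u a))| <= 2.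
  rewrite telescope_sumr //; apply: (le_trans (ler_normB _ _)).
  by have := cos_max (2 * pi * u N); have := cos_max (2 * pi * u 0%N); lra.
have cM a : (a < N)%N -> `|c a| <= 4 / lam.
  move=> aN; rewrite /c normrM normfV (gtr0_norm (s0 _ aN)).
  rewrite ler_pdivrMr ?s0 // (le_trans (cos_max _)) //.
  by have := sx _ aN; rewrite -ler_pdivrMl ?divr_gt0 // mulr1 invf_div.
have M0 : 0 <= 4 / lam by rewrite divr_ge0 // ltW.
have xi a : (a < N)%N -> 0 < x a < pi.
  by move=> /H /andP[h1 h2]; rewrite /x; apply/andP; split; nra.
have ab : `|\sum_(0 <= a < N) c a * (s a.+1 - s a)| <= 4 * (4 / lam).
  have s1 a : `|s a| <= 1 by exact: sin_max.
  case: mono => mono.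
    apply: abel_bound => // a aN; have aN' := ltnW aN.
    have /andP[? ?] := xi _ aN; have /andP[? ?] := xi _ aN'.
    by apply: cot_le => //; rewrite /x ler_pM2l ?pi_gt0 // mono.
  rewrite -normrN -sumrN.
  under eq_bigr do rewrite -mulNr.
  apply: (@abel_bound (fun a => - c a)) => // a aN; first by rewrite normrN cM.
  have aN' := ltnW aN.
  have /andP[? ?] := xi _ aN; have /andP[? ?] := xi _ aN'.
  by rewrite lerN2; apply: cot_le => //; rewrite /x ler_pM2l ?pi_gt0 // mono.
move: tele ab; rewrite !ler_norml => /andP[? ?] /andP[? ?].
by apply/andP; split; lra.
Qed.

(* The terms on which the increasing sequence [v] is at most [h^-k] in absolute
   value number at most [2h + 1]; off these, [v] has a constant sign. *)
Lemma sum_split_small (F v : nat -> R) N (k : nat) (h B : R) : 0 < h ->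
  (forall a, `|F a| <= 1) ->
  (forall a, (a < N)%N -> h ^- k.+1 <= fdiff v a) ->
  (forall m M, (m + M <= N)%N ->
     (forall a, (a < M)%N -> h ^- k <= v (m + a)%N) \/
     (forall a, (a < M)%N -> v (m + a)%N <= - h ^- k) ->
     `|\sum_(0 <= a < M) F (m + a)%N| <= B) ->
  `|\sum_(0 <= a < N) F a| <= 2 * B + 2 * h + 1.
Proof.
move=> h0 F1 vinc HB.
set lam := h ^- k in HB *; set mu := h ^- k.+1 in vinc.
have l0 : 0 < lam by rewrite invr_gt0 exprn_gt0.
have m0 : 0 < mu by rewrite invr_gt0 exprn_gt0.
have grow a b : (a + b <= N)%N -> mu * b%:R <= v (a + b)%N - v a.
  elim: b => [|b IH]; first by rewrite addn0 mulr0 subrr.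
  rewrite addnS => abN; have := IH (ltnW abN); have := vinc _ abN.
  by rewrite /fdiff -natr1 mulrDr mulr1; lra.
(* [p] and [r] are the first indices at which [v] exceeds [- lam], resp. reaches [lam]; the
   alternative [N <= _] makes both exist. *)
have exp : exists p, (N <= p)%N || (- lam < v p) by exists N; rewrite leqnn.
have exr : exists r, (N <= r)%N || (lam <= v r) by exists N; rewrite leqnn.
case: (ex_minnP exp) => p Pp minp; case: (ex_minnP exr) => r Pr minr.
have rN : (r <= N)%N by apply: minr; rewrite leqnn.
have pr : (p <= r)%N.
  apply: minp; case/orP: Pr => [->//|Pr]; apply/orP; right; lra.
have lowp a : (a < p)%N -> v a <= - lam.
  move=> ap; rewrite leNgt; apply/negP => va.
  by have := minp a; rewrite va orbT => /(_ isT); rewrite leqNgt ap.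
have rp : (r - p)%:R <= 2 * h + 1.
  have [->|rp] := eqVneq r p; first by rewrite subnn; lra.
  have {}rp : (p < r)%N by rewrite ltn_neqAle eq_sym rp pr.
  have vr : v r.-1 < lam.
    rewrite ltNge; apply/negP => vr.
    have := minr r.-1; rewrite vr orbT => /(_ isT); lia.
  have vp : - lam < v p.
    by case/orP: Pp => // Np; have := leq_trans rp rN; rewrite ltnNge Np.
  have e : (p + (r.-1 - p) = r.-1)%N by lia.
  have : mu * (r.-1 - p)%:R <= v r.-1 - v p by rewrite -{2}e grow // e; lia.
  have -> : (r - p = (r.-1 - p).+1)%N by lia.
  have lm : lam = h * mu by rewrite /lam /mu exprS invfM mulrA divff ?mul1r // gt_eqF.
  rewrite -natr1 lerD2r => H.
  have : mu * (r.-1 - p)%:R <= mu * (2 * h) by rewrite lm in vr vp; lra.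
  by rewrite ler_pM2l.
rewrite (big_cat_nat (leq0n p)) ?(leq_trans pr) //= (big_cat_nat pr rN) /=.
have A1 : `|\sum_(0 <= a < p) F a| <= B.
  have := HB 0%N p; apply; first lia.
  by right=> a ap; apply: lowp.
have A2 : `|\sum_(r <= a < N) F a| <= B.
  rewrite -{1}[r]add0n big_addn.
  under eq_bigr do rewrite addnC.
  apply: HB; first lia.
  case/orP: Pr => [Nr|vr].
    by left=> a; move: Nr; rewrite -subn_eq0 => /eqP ->.
  left=> a aN; have := grow r a.
  have : 0 <= mu * a%:R by rewrite mulr_ge0 // ltW.
  move=> ? /(_ _) H; have : mu * a%:R <= v (r + a)%N - v r by apply: H; lia.
  lra.
have A3 : `|\sum_(p <= a < r) F a| <= 2 * h + 1.
  apply: le_trans rp; apply: (le_trans (ler_norm_sum _ _ _)).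
  by apply: (le_trans (ler_sum _ (fun a _ => F1 a))); rewrite sumr_const_nat.
apply: (le_trans (ler_normD _ _)); have := ler_normD (\sum_(p <= a < r) F a) (\sum_(r <= a < N) F a).
lra.
Qed.

Lemma iter_fdiffN u k a : iter k fdiff (fun b => - u b) a = - iter k fdiff u a.
Proof.
by elim: k a => //= k IH a; rewrite /fdiff !IH opprB addrC opprK.
Qed.

Lemma iter_fdiff_shift u k m a :
  iter k fdiff (fun b => u (m + b)%N) a = iter k fdiff u (m + a)%N.
Proof. by elim: k a => //= k IH a; rewrite /fdiff !IH addnS. Qed.

(** Induction on the order: the difference of order k - 1 grows by at least [h ^- k] per step, so it
    exceeds [h ^- k.-1] in modulus off about 2h terms, and the previous case applies on both sides,
    to [- u] on the left. Writing the bounds as powers of one [h] keeps [h] unchanged through the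
    induction. *)
Lemma van_der_corput k : (2 <= k)%N -> exists2 C : R, 0 < C &
  forall u N (h : R), 1 <= h ->
  (forall a, (a < N)%N -> `|fdiff u a| <= 3 / 4) ->
  (forall a, (a < N)%N -> h ^- k <= iter k fdiff u a) ->
  `|\sum_(0 <= a < N) cos (2 * pi * u a)| <= C * h.
Proof.
elim: k => // k IH; rewrite leq_eqVlt => /orP[/eqP [<-]|k2].
  (* 21 = 2 * 9 + 2 + 1: each outer range costs at most 9h by Kusmin-Landau with [lam] = 1/h. *)
  exists 21 => // u N h h1 du ddu; have h0 : 0 < h by apply: lt_le_trans h1.
  have hl : 1 + 8 / h ^- 1 <= 9 * h by rewrite expr1 invrK; lra.
  apply: (le_trans (y := 2 * (9 * h) + 2 * h + 1)); last lra.
  apply: (@sum_split_small _ (fdiff u) N 1%N h) => //.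
    by move=> a; exact: cos_max.
  move=> m M mMN; have l0 : 0 < h ^- 1 by rewrite invr_gt0 exprn_gt0.
  have inc a : (a < N)%N -> fdiff u a <= fdiff u a.+1.
    move=> aN; rewrite -subr_ge0; apply: le_trans (ddu a aN).
    by rewrite invr_ge0 exprn_ge0 // ltW.
  have dul a : (a < M)%N -> `|fdiff u (m + a)| <= 3 / 4 by move=> aM; apply: du; lia.
  case=> H; apply: le_trans hl.
    apply: (@kusmin_landau (fun a => u (m + a)%N)) => //.
      move=> a aM; rewrite /fdiff addnS -[_ - _]/(fdiff u (m + a)) H //=.
      by have := dul a aM; rewrite ler_norml => /andP[].
    left=> a aM; rewrite /fdiff !addnS; apply: inc; lia.
  under eq_bigr do rewrite -cosN -mulrN.
  apply: (@kusmin_landau (fun a => - u (m + a)%N)) => //.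
    move=> a aM; rewrite /fdiff addnS -opprD -[_ - _]/(fdiff u (m + a)).
    have := H a aM; have := dul a aM; rewrite ler_norml => /andP[? ?] ?.
    by apply/andP; split; lra.
  right=> a aM; rewrite /fdiff !addnS -!opprD lerN2; apply: inc; lia.
have [C C0 HC] := IH k2.
exists (2 * C + 3) => [|u N h h1 du ddu]; first by rewrite addr_gt0 // mulr_gt0.
have h0 : 0 < h by apply: lt_le_trans h1.
apply: (le_trans (y := 2 * (C * h) + 2 * h + 1)); last nra.
apply: (@sum_split_small _ (iter k fdiff u) N k h) => //.
  by move=> a; exact: cos_max.
move=> m M mMN.
have dul a : (a < M)%N -> `|fdiff u (m + a)| <= 3 / 4 by move=> aM; apply: du; lia.
case=> H.
  apply: (HC (fun a => u (m + a)%N)) => // a aM.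
    by rewrite /fdiff addnS; exact: dul.
  by rewrite iter_fdiff_shift H.
under eq_bigr do rewrite -cosN -mulrN.
apply: (HC (fun a => - u (m + a)%N)) => // a aM.
  by rewrite /fdiff addnS -opprD normrN; exact: dul.
rewrite (iter_fdiffN (fun b => u (m + b)%N)) iter_fdiff_shift lerNr.
exact: H.
Qed.

End ExponentialSums.

(** * From derivatives to finite differences on a short block *)

Section BlockBound.
Variable R : realType.
Implicit Types (phi : nat -> R -> R).

Lemma mean_value (g dg : R -> R) (a b : R) : a <= b ->
  (forall x, a <= x <= b -> is_derive x 1 g (dg x)) ->
  exists2 c, a <= c <= b & g b - g a = dg c * (b - a).
Proof.
move=> ab dgP; have [c cab E] : exists2 c, c \in `[a, b]%R & g b - g a = dg c * (b - a).
  apply: MVT_segment => //.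
    move=> x; rewrite in_itv /= => /andP[ax xb].
    by apply: dgP; rewrite !ltW.
  apply: derivable_within_continuous => y; rewrite in_itv /= => yab.
  by have [] := dgP y yab.
by exists c => //; move: cab; rewrite in_itv.
Qed.

Lemma is_derive_translate (g : R -> R) (y s dg : R) :
  is_derive (y + s) 1 g dg -> is_derive y 1 (fun z => g (z + s)) dg.
Proof.
move=> H; have -> : (fun z => g (z + s)) = g \o (fun z => z + s) by [].
have H2 : is_derive y 1 (fun z : R => z + s) 1.
  by apply: is_derive_eq; rewrite addr0.
by have := @is_derive1_comp R g (fun z => z + s) y dg 1 H H2; rewrite mulr1.
Qed.

(** [phi] is a tower: [phi i.+1] is the derivative of [phi i]. Differencing once replaces it by the
    tower of [phi i (y + s) - phi i y], whose member of order k is [s * phi k.+1 c] by the mean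
    value theorem. *)
Lemma iter_fdiff_ge phi k (x s mu : R) : 0 <= s ->
  (forall i y, x <= y <= x + k%:R * s -> is_derive y 1 (phi i) (phi i.+1 y)) ->
  (forall y, x <= y <= x + k%:R * s -> mu <= phi k y) ->
  s ^+ k * mu <= iter k (@fdiff R) (fun a => phi 0%N (x + a%:R * s)) 0%N.
Proof.
move=> s0; elim: k phi mu => [|k IH] phi mu dphi lphi.
  by rewrite expr0 mul1r /= mul0r addr0; apply: lphi; rewrite mul0r addr0 lexx.
rewrite iterSr; pose psi i y := phi i (y + s) - phi i y.
have ks : k.+1%:R * s = k%:R * s + s by rewrite -natr1 mulrDl mul1r.
have ks0 : 0 <= k%:R * s by rewrite mulr_ge0.
have -> : fdiff (fun a => phi 0%N (x + a%:R * s)) = (fun a => psi 0%N (x + a%:R * s)).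
  by apply/funext => a; rewrite /fdiff /psi -natr1 mulrDl mul1r addrA.
rewrite exprSr -mulrA; apply: IH => [i|] y /andP[xy yk].
  apply: is_deriveB.
    by apply: is_derive_translate; apply: dphi; apply/andP; split; lra.
  by apply: dphi; apply/andP; split; lra.
have [c /andP[c1 c2] E] : exists2 c, y <= c <= y + s &
    phi k (y + s) - phi k y = phi k.+1 c * (y + s - y).
  apply: mean_value; first lra.
  by move=> z /andP[z1 z2]; apply: dphi; apply/andP; split; lra.
rewrite /psi E addrAC subrr add0r mulrC ler_wpM2r // lphi //.
by apply/andP; split; lra.
Qed.

Lemma cos_int_shift (x : R) (m : int) (a : nat) :
  cos (2 * pi * (x - a%:R * m%:~R)) = cos (2 * pi * x).
Proof.
rewrite -[RHS](cosD2piz _ (- (a%:Z * m))); congr cos.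
by rewrite mulrNz rmorphM /=; ring.
Qed.

(* A run of [N] terms so short that [phi'] and [phi^(k)] are almost constant on it;
   subtracting the integer nearest to [phi'] from the frequency does not change
   the cosines. *)
Lemma block_bound k : (2 <= k)%N -> exists2 C : R, 0 < C &
  forall phi (t q h c : R) N, 1 <= q -> 1 <= h -> c <= 1 / 2 ->
  (forall i y, t <= y <= t + (N + k)%:R / q -> is_derive y 1 (phi i) (phi i.+1 y)) ->
  (forall i y, (0 < i <= k)%N -> t <= y <= t + (N + k)%:R / q -> `|phi i y - phi i t| <= c / 2) ->
  c <= `|phi k t| ->
  h ^- k <= q * (q ^- k * (`|phi k t| / 2)) ->
  `|\sum_(0 <= a < N) cos (2 * pi * (q * phi 0%N (t + a%:R / q)))| <= C * h.
Proof.
move=> k2; have [C C0 HC] := van_der_corput R k2; exists C => //.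
move=> phi t q h c N q1 h1 c1 dphi var ck hk.
wlog pos : phi dphi var ck hk / 0 <= phi k t => [H|].
  have [/H|/ltW neg] := leP 0 (phi k t); first exact.
  under eq_bigr do rewrite -cosN -mulrN -mulrN.
  apply: (H (fun i y => - phi i y)).
  - by move=> i y ty; apply: is_deriveN; exact: dphi.
  - by move=> i y ik ty; rewrite -opprD normrN; exact: var.
  - by rewrite normrN.
  - by rewrite normrN.
  - by rewrite oppr_ge0.
have q0 : 0 < q by apply: lt_le_trans q1.
have inI a : (a <= N + k)%N -> t <= t + a%:R / q /\ t + a%:R / q <= t + (N + k)%:R / q.
  move=> aN; split; first by rewrite lerDl divr_ge0 // ltW.
  by rewrite lerD2l ler_pM2r ?invr_gt0 // ler_nat.
pose m := Num.floor (phi 1%N t + 1 / 2).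
have mP : `|phi 1%N t - m%:~R| <= 1 / 2.
  have := floor_itv (phi 1%N t + 1 / 2); rewrite -/m => /andP[].
  by rewrite intrD mulr1z ler_norml => ? ?; apply/andP; split; lra.
pose u (a : nat) := q * phi 0%N (t + a%:R / q) - a%:R * m%:~R.
have -> : \sum_(0 <= a < N) cos (2 * pi * (q * phi 0%N (t + a%:R / q))) =
    \sum_(0 <= a < N) cos (2 * pi * u a).
  by apply: eq_bigr => a _; rewrite cos_int_shift.
have kN a : (a < N)%N -> (a + k <= N + k)%N by move=> /ltnW; rewrite leq_add2r.
apply: HC => // a aN.
  have [t1 t2] := inI a (leq_trans (leq_addr k a) (kN _ aN)).
  have [t3 t4] : t <= t + a.+1%:R / q /\ t + a.+1%:R / q <= t + (N + k)%:R / q.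
    by apply: inI => //; rewrite (leq_trans aN) // leq_addr.
  have [x /andP[x1 x2] E] : exists2 x, t + a%:R / q <= x <= t + a.+1%:R / q &
     phi 0%N (t + a.+1%:R / q) - phi 0%N (t + a%:R / q) =
     phi 1%N x * (t + a.+1%:R / q - (t + a%:R / q)).
    apply: mean_value; first by rewrite lerD2l ler_pM2r ?invr_gt0 // ler_nat.
    by move=> x /andP[? ?]; apply: dphi; apply/andP; split; lra.
  have -> : fdiff u a = phi 1%N x - m%:~R.
    transitivity (q * (phi 0%N (t + a.+1%:R / q) - phi 0%N (t + a%:R / q)) - m%:~R).
      by rewrite /fdiff /u -natr1; ring.
    rewrite E -natr1; field; exact: lt0r_neq0.
  have x3 : t <= x <= t + (N + k)%:R / q by apply/andP; split; lra.
  have := var 1%N x _ x3; rewrite (leq_trans _ k2) // => /(_ isT).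
  move: mP; rewrite !ler_norml => /andP[? ?] /andP[? ?].
  by apply/andP; split; lra.
(* The subtracted term [a * m] is linear in [a], so it disappears from the second difference on;
   this is where [2 <= k] enters. *)
have itq : iter k (@fdiff R) (fun b => u (a + b)%N) 0%N =
   q * iter k (@fdiff R) (fun b => phi 0%N ((t + a%:R / q) + b%:R * q^-1)) 0%N.
  clear -k2 q0; case: k k2 => // -[//|k] _.
  have E : forall g : nat -> R, iter k (@fdiff R) (fun b => q * g b) 0%N = q * iter k (@fdiff R) g 0%N.
    move=> g; suff H : forall b, iter k (@fdiff R) (fun b => q * g b) b = q * iter k (@fdiff R) g b by [].
    by elim: k => //= j IHj b; rewrite /fdiff !IHj mulrBr.
  rewrite !iterSr -E; congr (iter k _ _ _); apply/funext => b.
  rewrite /fdiff /u !addnS -!natr1 !natrD.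
  have -> : t + (a%:R + b%:R + 1 + 1) / q = t + a%:R / q + (b%:R + 1 + 1) / q by ring.
  have -> : t + (a%:R + b%:R + 1) / q = t + a%:R / q + (b%:R + 1) / q by ring.
  have -> : t + (a%:R + b%:R) / q = t + a%:R / q + b%:R / q by ring.
  ring.
have := iter_fdiff_shift u k a 0%N; rewrite addn0 => <-; rewrite itq.
have [ta1 ta2] := inI (a + k)%N (kN _ aN).
have [ta3 _] := inI a (leq_trans (leq_addr k a) (kN _ aN)).
have up : t + a%:R / q + k%:R * q^-1 <= t + (N + k)%:R / q.
  by move: ta2; rewrite natrD mulrDl addrA.
have H := @iter_fdiff_ge phi k (t + a%:R / q) q^-1 (phi k t / 2).
(* On the block [phi k] stays above half its initial value, as it varies by at most [c / 2] and
   [c <= phi k t]. *)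
apply: (le_trans (y := q * (q^-1 ^+ k * (phi k t / 2)))); last first.
  rewrite ler_pM2l //; apply: H.
  - by rewrite invr_ge0 ltW.
  - by move=> i y /andP[? ?]; apply: dphi; apply/andP; split; lra.
  move=> y /andP[? ?]; have := var k y; rewrite (leq_trans _ k2) // leqnn.
  move=> /(_ isT) V; have {V} : `|phi k y - phi k t| <= c / 2.
    by apply: V; apply/andP; split; lra.
  move: ck; rewrite (ger0_norm pos) ler_norml => ck /andP[? ?].
  lra.
by move: hk; rewrite (ger0_norm pos) exprVn.
Qed.

End BlockBound.

(** * Summation over the frequencies *)

Section Counting.
Variable R : realType.

(** The induction step is x^(1-alpha) <= (x + 1/2) (x+1)^(-alpha), which follows from
    ((x+1)/x)^alpha <= sqrt((x+1)/x) <= 1 + 1/(2x) since alpha <= 1/2. *)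
Lemma sum_powR_le (alpha : R) M : 0 < alpha <= 1 / 2 ->
  \sum_(1 <= m < M.+1) m%:R `^ (- alpha) <= 2 * M%:R `^ (1 - alpha) :> R.
Proof.
move=> /andP[a0 a1]; elim: M => [|M IH].
  by rewrite big_geq // mulr_ge0 // powR_ge0.
rewrite big_nat_recr //=; apply: (le_trans (lerD IH (lexx _))).
have P (x : R) : 0 < x -> x `^ (1 - alpha) = x * x `^ (- alpha).
  move=> x0; rewrite powRD; last by rewrite (gt_eqF x0) /= implybT.
    by rewrite powRr1 // ltW.
have [->|M0] := eqVneq M 0%N.
  rewrite powR0; last by rewrite gt_eqF // subr_gt0; lra.
  by rewrite mulr0 add0r !powR1; lra.
have x0 : 0 < M%:R :> R by rewrite ltr0n lt0n.
have y0 : 0 < M.+1%:R :> R by rewrite ltr0n.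
rewrite !P //; set Y := M.+1%:R `^ _.
have Y0 : 0 <= Y by exact: powR_ge0.
set x : R := M%:R in x0 *; have yx : M.+1%:R = x + 1 :> R by rewrite -natr1.
have H : x * x `^ (- alpha) <= (x + 1 / 2) * Y.
  have -> : x `^ (- alpha) = Y * ((x + 1) / x) `^ alpha.
    have r0 : 0 < (x + 1) / x by rewrite divr_gt0 // addr_gt0.
    have {1}-> : Y = x `^ (- alpha) * ((x + 1) / x) `^ (- alpha).
      by rewrite -powRM ?ltW // /Y yx; congr (_ `^ _); field; rewrite lt0r_neq0.
    by rewrite (powRN ((x + 1) / x)) -mulrA mulVf ?mulr1 // gt_eqF // powR_gt0.
  have r1 : 1 <= (x + 1) / x by rewrite ler_pdivlMr // mul1r lerDl.
  have : ((x + 1) / x) `^ alpha <= 1 + 1 / (2 * x).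
    apply: (le_trans (ler_powR r1 a1)).
    have -> : 1 / 2 = 2^-1 :> R by rewrite div1r.
    rewrite powR12_sqrt; last by lra.
    rewrite -[leRHS]ger0_norm; last by rewrite addr_ge0 // divr_ge0 // mulr_ge0 // ltW.
    rewrite -sqrtr_sqr ler_sqrt; last by exact: sqr_ge0.
    have -> : (1 + 1 / (2 * x)) ^+ 2 = (x + 1) / x + (1 / (2 * x)) ^+ 2.
      by field; rewrite lt0r_neq0.
    by rewrite lerDl sqr_ge0.
  set r := (_ `^ alpha) => rle.
  apply: (le_trans (y := x * (Y * (1 + 1 / (2 * x))))).
    by rewrite ler_pM2l // ler_wpM2l.
  by rewrite le_eqVlt; apply/orP; left; apply/eqP; field; rewrite lt0r_neq0.
rewrite yx; lra.
Qed.

(** The component in [E] is a label separating the elements of a fibre of the first component, which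
    therefore has at most [#|E|] elements. *)
Lemma sum_inj_le (T Z E : finType) (h : T -> Z * E) (w : Z -> R) :
  injective h -> (forall z, 0 <= w z) ->
  \sum_l w (h l).1 <= #|E|%:R * \sum_z w z.
Proof.
move=> hi w0.
have -> : \sum_l w (h l).1 = \sum_(y in h @: T) w y.1.
  by rewrite big_imset //= => x y _ _; exact: hi.
apply: (le_trans (y := \sum_(y : Z * E) w y.1)).
  rewrite [leRHS](bigID (mem (h @: T))) /= lerDl sumr_ge0 // => y _; exact: w0.
have -> : \sum_(y : Z * E) w y.1 = \sum_z \sum_(e : E) w z by rewrite pair_bigA /=.
rewrite mulr_sumr le_eqVlt.
apply/orP; left; apply/eqP; apply: eq_bigr => z _.
by rewrite sumr_const -[LHS]mulr_natl.
Qed.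

(* Weight of the coordinate [i] of a shifted floor vector when the derivative of
   order [p + 2] is the first one which is not small. *)
Definition floor_weight (alpha : R) (M : nat) (p i Z : nat) : R :=
  if (i < p)%N then ((Z == M.-1) || (Z == M))%:R
  else if i == p then (`|Z%:R - M%:R| + 1) `^ (- alpha) else 1.

Lemma floor_weight_ge0 alpha M p i Z : 0 <= floor_weight alpha M p i Z.
Proof. by rewrite /floor_weight; case: ifP => // _; case: ifP => // _; exact: powR_ge0. Qed.

(** In the middle case [|Z - M| + 1] takes each positive integer at most once on either side of [M],
    so each side is bounded by [sum_powR_le]. *)
Lemma sum_floor_weight (alpha : R) M p i : 0 < alpha <= 1 / 2 -> (0 < M)%N ->
  \sum_(Z < M + M) floor_weight alpha M p i Z <=
  if (i < p)%N then 2 else if i == p then 4 * M%:R `^ (1 - alpha) else 2 * M%:R.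
Proof.
move=> al M0; rewrite /floor_weight; case: ifP => ip.
  have p1 : (M.-1 < M + M)%N by lia.
  have p2 : (M < M + M)%N by lia.
  rewrite -natr_sum ler_nat.
  have -> : (\sum_(Z < M + M) ((Z == M.-1 :> nat) || (Z == M :> nat)) =
      #|[pred Z : 'I_(M + M) | (Z == M.-1 :> nat) || (Z == M :> nat)]|)%N.
    by rewrite -sum1_card [RHS]big_mkcond /=; apply: eq_bigr => Z _; rewrite inE; case: (_ || _).
  apply: (leq_trans (n := #|pred2 (Ordinal p1) (Ordinal p2)|)); last by rewrite card2; case: eqP.
  by apply: subset_leq_card; apply/fintype.subsetP => Z; rewrite !inE.
case: ifP => _; last by rewrite sumr_const card_ord natrD; lra.
have /andP[a0 a1] := al.
rewrite -(big_mkord xpredT (fun Z => (`|Z%:R - M%:R| + 1) `^ (- alpha) : R)).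
rewrite (big_cat_nat (n := M)) ?leq_addr //=.
have H1 := sum_powR_le M al.
have e1 : \sum_(0 <= Z < M) (`|Z%:R - M%:R| + 1) `^ (- alpha) <= \sum_(1 <= m < M.+1) m%:R `^ (- alpha) :> R.
  rewrite big_nat_rev big_add1 /= add0n; apply: ler_sum_nat => i0 /andP[_ iM].
  have -> : (M - i0.+1)%:R - M%:R = - i0.+1%:R :> R by rewrite natrB // addrAC subrr sub0r.
  rewrite normrN ger0_norm //.
  have P : 0 < i0.+1%:R :> R by rewrite ltr0n.
  have P1 : 0 < i0.+1%:R + 1 :> R by rewrite addr_gt0.
  rewrite !powRN lef_pV2 ?posrE ?powR_gt0 //.
  by apply: ge0_ler_powR; rewrite ?nnegrE ?ltW // ltrDl.
have e2 : \sum_(M <= Z < M + M) (`|Z%:R - M%:R| + 1) `^ (- alpha) = \sum_(1 <= m < M.+1) m%:R `^ (- alpha) :> R.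
  rewrite -{1}[M]add0n big_addn addnK big_add1 /=; apply: eq_bigr => i0 _.
  by rewrite natrD addrK ger0_norm // natr1.
lra.
Qed.

Lemma prod_three_ranges d (p : 'I_d) (x y z : R) :
  \prod_(i < d) (if (i < p)%N then x else if (i : nat) == p then y else z)
  = x ^+ p * y * z ^+ (d - p.+1).
Proof.
rewrite -(big_mkord xpredT (fun i => if (i < p)%N then x else if i == p then y else z)).
rewrite (big_cat_nat (n := p)) ?(ltnW (ltn_ord p)) //= (big_ltn (ltn_ord p)) /= ltnn eqxx mulrA.
congr (_ * _ * _).
  rewrite (eq_big_nat _ _ (F2 := fun=> x)); last by move=> i /andP[_ ->].
  by rewrite prodr_const_nat subn0.
rewrite (eq_big_nat _ _ (F2 := fun=> z)); last first.
  by move=> i /andP[pi _]; rewrite ltnNge (ltnW pi) /= gtn_eqF.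
by rewrite prodr_const_nat.
Qed.

Variables (d : nat) (A : 'I_d -> 'I_d -> R) (B C0 L : nat).
Hypothesis A_bound : forall i p, `|A i p| <= B%:R.
Hypothesis A_inv : forall (x : 'I_d -> R) (s : R),
  (forall p, `|\sum_i x i * A i p| <= s) -> forall i, `|x i| <= C0%:R * s.
Variable k : {ffun 'I_d -> 'I_L}.

(** When [A i p] is the derivative of order p + 2 of the i-th coordinate function, this is the
    derivative of that order of the phase with frequency [k - l]. *)
Definition dual_coord (l : {ffun 'I_d -> 'I_L}) (p : 'I_d) : R :=
  \sum_i ((k i)%:R - (l i)%:R) * A i p.

Let M := (d * B * L).+1.

Lemma dual_coord_bound l p : `|dual_coord l p| <= (d * B * L)%:R.
Proof.
apply: (le_trans (ler_norm_sum _ _ _)).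
apply: (le_trans (y := \sum_(i < d) (B * L)%:R)); last first.
  by rewrite sumr_const card_ord -[_ *+ _]mulr_natl -natrM mulnA.
apply: ler_sum => i _; rewrite normrM mulrC natrM; apply: ler_pM => //.
have ki : (k i)%:R <= L%:R :> R by rewrite ler_nat ltnW.
have li : (l i)%:R <= L%:R :> R by rewrite ler_nat ltnW.
have k0 : 0 <= (k i)%:R :> R by [].
have l0 : 0 <= (l i)%:R :> R by [].
by rewrite ler_norml; apply/andP; split; lra.
Qed.

(** Adding [M] makes the floor a natural number below [M + M], so that it can index a finite
    type. *)
Definition floor_index l (p : 'I_d) : nat :=
  absz (Num.floor (dual_coord l p) + (M : int)).

Lemma floor_indexE l p :
  (floor_index l p)%:R = (Num.floor (dual_coord l p))%:~R + M%:R :> R.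
Proof.
have := dual_coord_bound l p; rewrite ler_norml => /andP[h _].
have : (- (d * B * L)%:Z <= Num.floor (dual_coord l p))%R.
  by rewrite floor_ge_int rmorphN /=.
rewrite -[RHS](intrD _ _ (M : int)) => h2.
rewrite /floor_index -[LHS]/((Posz _)%:~R) gez0_abs //; rewrite /M; lia.
Qed.

Lemma floor_index_lt l p : (floor_index l p < M + M)%N.
Proof.
rewrite -(ltr_nat R) floor_indexE natrD ltrD2r.
apply: (le_lt_trans (floor_le _)).
have := dual_coord_bound l p; rewrite ler_norml => /andP[_ h].
by rewrite (le_lt_trans h) // ltr_nat.
Qed.

(** The floors of the dual coordinates together with the residues of [l] modulo [C0 + 1] determine
    [l]: equal floors force [|l i - l' i| <= C0] by [A_inv], and then equal residues force equality.
    So the sum is at most [(C0 + 1)^d] times a sum over all floor vectors, which factors over the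
    coordinates. *)
Lemma sum_dual_weight (p : 'I_d) (alpha : R) : 0 < alpha <= 1 / 2 ->
  \sum_(l : {ffun 'I_d -> 'I_L}) \prod_(i < d) floor_weight alpha M p i (floor_index l i) <=
  (C0.+1 ^ d)%:R * (4 * 2 ^+ d.-1 * M%:R ^+ (d - p.+1) * M%:R `^ (1 - alpha)).
Proof.
move=> al.
pose h l : {ffun 'I_d -> 'I_(M + M)} * {ffun 'I_d -> 'I_C0.+1} :=
  ([ffun i => Ordinal (floor_index_lt l i)], [ffun i => inord (l i %% C0.+1)]).
have hinj : injective h.
  move=> l l' [] /ffunP e1 /ffunP e2.
  have D i : `|(l' i)%:R - (l i)%:R| <= C0%:R * 1 :> R.
    apply: (@A_inv (fun i => (l' i)%:R - (l i)%:R) 1) => p0.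
    have -> : \sum_i0 ((l' i0)%:R - (l i0)%:R) * A i0 p0 = dual_coord l p0 - dual_coord l' p0.
      by rewrite /dual_coord -sumrB; apply: eq_bigr => j _; ring.
    have := e1 p0; rewrite !ffunE => /(congr1 val) /= /(congr1 (fun n => n%:R : R)).
    rewrite !floor_indexE => /addIr E.
    have := floor_itv (dual_coord l p0); have := floor_itv (dual_coord l' p0).
    rewrite !intrD !mulr1z E => /andP[? ?] /andP[? ?].
    by rewrite ler_norml; apply/andP; split; lra.
  apply/ffunP => i; apply/val_inj => /=.
  have := e2 i; rewrite !ffunE => /(congr1 val) /=; rewrite !inordK ?ltn_mod // => e3.
  have := D i; rewrite mulr1 ler_norml => /andP[].
  rewrite -subr_ge0 opprK addrAC subr_ge0 -natrD ler_nat => d1.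
  rewrite lerBlDr -natrD ler_nat => d2.
  move: d1 d2 e3; set a := val (l i); set b := val (l' i) => d1 d2 e3.
  have := divn_eq a C0.+1; have := divn_eq b C0.+1.
  rewrite e3; set x := (_ %/ _)%N; set y := (_ %/ _)%N; set r := (_ %% _)%N.
  move=> E1 E2; have [xy|xy|xy] := ltngtP x y; last by rewrite E1 E2 xy.
    have : (x.+1 * C0.+1 <= y * C0.+1)%N by rewrite leq_mul2r xy orbT.
    by rewrite mulSn; lia.
  have : (y.+1 * C0.+1 <= x * C0.+1)%N by rewrite leq_mul2r xy orbT.
  by rewrite mulSn; lia.
pose w (Z : {ffun 'I_d -> 'I_(M + M)}) : R := \prod_(i < d) floor_weight alpha M p i (Z i).
have w0 Z : 0 <= w Z by apply: prodr_ge0 => i _; exact: floor_weight_ge0.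
have := sum_inj_le hinj w0.
rewrite card_ffun !card_ord.
have -> : \sum_l w (h l).1 = \sum_l \prod_(i < d) floor_weight alpha M p i (floor_index l i).
  by apply: eq_bigr => l _; apply: eq_bigr => i _; rewrite ffunE.
move=> /le_trans; apply; apply: ler_wpM2l => //.
rewrite -(bigA_distr_bigA (fun (i : 'I_d) (Z : 'I_(M + M)) => floor_weight alpha M p i Z)).
apply: (le_trans (y := \prod_(i < d) (if (i < p)%N then 2
    else if (i : nat) == p then 4 * M%:R `^ (1 - alpha) else 2 * M%:R))).
  apply: ler_prod => i _; rewrite sumr_ge0 /=; last by move=> Z _; exact: floor_weight_ge0.
  exact: sum_floor_weight.
rewrite prod_three_ranges exprMn.
have e : d.-1 = (p + (d - p.+1))%N by have := ltn_ord p; lia.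
by rewrite e exprD le_eqVlt; apply/orP; left; apply/eqP; ring.
Qed.

End Counting.

(** * Cutting into blocks, and the inequality between powers of q and L *)

Section BlockDecomposition.
Variable R : realType.

Lemma sum_blocks_le (G : nat -> R) N b K :
  `|\sum_(0 <= a < minn N (K * b)) G a| <=
  \sum_(m < K) `|\sum_(0 <= r < minn b (N - m * b)) G (m * b + r)%N|.
Proof.
elim: K => [|K IH]; first by rewrite mul0n minn0 big_geq // normr0 big_ord0.
rewrite big_ord_recr /=.
have le : (minn N (K * b) <= minn N (K.+1 * b))%N by rewrite mulSn; lia.
rewrite (big_cat_nat (leq0n _) le) /=.
apply: (le_trans (ler_normD _ _)); apply: (lerD IH).
rewrite -{1}[minn N (K * b)]add0n big_addn.
have -> : (minn N (K.+1 * b) - minn N (K * b) = minn b (N - K * b))%N.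
  by rewrite mulSn; lia.
have [h|h] := leqP (K * b) N.
  by under eq_bigr do rewrite addnC.
have -> : (minn b (N - K * b) = 0)%N by lia.
by rewrite !big_geq.
Qed.

Lemma frequency_term_le (eta : R) (q L d p D : nat) :
  0 < eta <= 1 -> (0 < q)%N -> (0 < L)%N -> (p < d)%N ->
  (p.+2 * (d - p).+1 <= D.+1)%N -> L%:R ^+ D <= eta ^+ d.+1 * q%:R ->
  L%:R * (q%:R `^ (1 - p.+2%:R^-1) * (L%:R ^+ (d - p.+1) * L%:R `^ (1 - p.+2%:R^-1)))
  <= eta * q%:R.
Proof.
move=> /andP[e0 e1] q0 L0 pd pD LD.
set alpha : R := p.+2%:R^-1.
have qR : 0 < q%:R :> R by rewrite ltr0n.
have LR : 0 < L%:R :> R by rewrite ltr0n.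
have L1 : 1 <= L%:R :> R by rewrite ler1n.
have P (x : R) : 0 < x -> x `^ (1 - alpha) = x / x `^ alpha.
  move=> x0; rewrite powRD; last by rewrite (gt_eqF x0) /= implybT.
  by rewrite powRr1 ?powRN // ltW.
have qa : 0 < q%:R `^ alpha by rewrite powR_gt0.
have La : 0 < L%:R `^ alpha by rewrite powR_gt0.
have root (x : R) : 0 <= x -> (x ^+ p.+2) `^ alpha = x.
  by move=> x0; rewrite -powR_mulrn // -powRrM /alpha divff ?powRr1 // pnatr_eq0.
have a0 : 0 < alpha by rewrite invr_gt0 ltr0n.
have key : L%:R ^+ (d - p).+1 <= eta * (q%:R `^ alpha * L%:R `^ alpha).
  have e0' := ltW e0; have q0' := ltW qR; have L0' := ltW LR.
  have -> : eta * (q%:R `^ alpha * L%:R `^ alpha) = (eta ^+ p.+2 * (q%:R * L%:R)) `^ alpha.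
    rewrite (@powRM _ (eta ^+ p.+2)); [|by rewrite exprn_ge0|by rewrite mulr_ge0].
    by rewrite (root eta) // (@powRM _ q%:R).
  have Ln0 : 0 <= L%:R ^+ (d - p).+1 :> R by rewrite exprn_ge0.
  rewrite -(root _ Ln0).
  apply: ge0_ler_powR; [exact: ltW|by rewrite nnegrE exprn_ge0| |].
    by rewrite nnegrE; apply: mulr_ge0; [rewrite exprn_ge0|rewrite mulr_ge0].
  rewrite -exprM; apply: (le_trans (y := L%:R ^+ D.+1)).
    by apply: ler_weXn2l => //; rewrite mulnC.
  rewrite exprS mulrA [leRHS]mulrC ler_pM2l //; apply: (le_trans LD).
  by rewrite ler_pM2r //; apply: ler_wiXn2l => //; exact: ltW.
rewrite !P //.
have -> : L%:R * (q%:R / q%:R `^ alpha * (L%:R ^+ (d - p.+1) * (L%:R / L%:R `^ alpha))) =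
   q%:R * (L%:R ^+ (d - p).+1 / (q%:R `^ alpha * L%:R `^ alpha)).
  have -> : ((d - p).+1 = (d - p.+1).+2)%N by move: pd; clear; lia.
  by rewrite !exprS; field; rewrite !gt_eqF.
rewrite [leRHS]mulrC ler_pM2l // ler_pdivrMr //; exact: mulr_gt0.
Qed.

End BlockDecomposition.

(** * Row sums of the cosine sums along the curve *)

Section FrequencySum.
Variables (R : realType) (d : nat) (F : 'I_d -> nat -> R -> R) (B C0 : nat).
Hypothesis d_gt0 : (0 < d)%N.
Hypothesis B_gt0 : (0 < B)%N.
Hypothesis C0_gt0 : (0 < C0)%N.
Hypothesis F_derive : forall i k (y : R), -2 <= y <= 2 ->
  is_derive y 1 (F i k) (F i k.+1 y).
Hypothesis F_bound : forall i k (y : R), (k <= d.+2)%N -> -2 <= y <= 2 -> `|F i k y| <= B%:R.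
Hypothesis F_nondeg : forall (t : R) (x : 'I_d -> R) (s : R), -2 <= t <= 2 ->
  (forall p : 'I_d, `|\sum_i x i * F i p.+2 t| <= s) ->
  forall i, `|x i| <= C0%:R * s.

Let A (t : R) (i p : 'I_d) := F i p.+2 t.
Let c0 : R := 1 / (2 * C0%:R).
Let alpha (p : nat) : R := p.+2%:R^-1.

Let C0_ge1 : 1 <= C0%:R :> R. Proof. by rewrite ler1n. Qed.
Let c0_gt0 : 0 < c0. Proof. by rewrite divr_gt0 // mulr_gt0 // ltr0n. Qed.
Let c0_le : c0 <= 1 / 2.
Proof. by rewrite /c0 ler_pdivrMr ?mulr_gt0 ?ltr0n //; move: C0_ge1; lra. Qed.

Let alpha_bounds p : 0 < alpha p <= 1 / 2.
Proof.
rewrite /alpha invr_gt0 ltr0n /= div1r lef_pV2 ?posrE ?ltr0n //.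
by rewrite (ler_nat _ 2).
Qed.

Lemma phase_derive_le (x : 'I_d -> R) (s : R) k (y : R) : (k <= d.+2)%N -> -2 <= y <= 2 ->
  (forall i, `|x i| <= s) -> `|\sum_i x i * F i k y| <= d%:R * s * B%:R.
Proof.
move=> kd y2 xs; apply: (le_trans (ler_norm_sum _ _ _)).
apply: (le_trans (y := \sum_(i < d) s * B%:R)); last first.
  by rewrite sumr_const card_ord -[_ *+ _]mulr_natl mulrA.
by apply: ler_sum => i _; rewrite normrM; apply: ler_pM => //; exact: F_bound.
Qed.

(** If all the derivatives were below [c0], nondegeneracy would give [|x i| <= C0 * c0 = 1/2] for
    every i; the first order at which this fails is chosen. *)
Lemma first_large_derivative (x : 'I_d -> R) (t : R) : -2 <= t <= 2 ->
  (exists i, 1 <= `|x i|) ->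
  exists p : 'I_d, c0 <= `|\sum_i x i * A t i p| /\
    forall i : 'I_d, (i < p)%N -> `|\sum_j x j * A t j i| < c0.
Proof.
move=> t2 [i xi].
have [p0 p0P] : exists p : 'I_d, c0 <= `|\sum_i x i * A t i p|.
  apply/not_existsP => H; have := F_nondeg (x := x) (s := c0) t2.
  move=> /(_ (fun p => _)) => K; have {K} : `|x i| <= C0%:R * c0.
    by apply: K => p; have /negP := H p; rewrite -ltNge => /ltW.
  have -> : C0%:R * c0 = 1 / 2 by rewrite /c0; field; rewrite pnatr_eq0 -lt0n.
  lra.
have exn : exists n, [exists p : 'I_d, (val p == n) && (c0 <= `|\sum_i x i * A t i p|)].
  by exists (val p0); apply/existsP; exists p0; rewrite eqxx.
case: (ex_minnP exn) => n /existsP[p /andP[/eqP pn pP]] minn.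
exists p; split => // j jp; rewrite ltNge; apply/negP => jP.
have := minn j; rewrite -pn leqNgt jp => /(_ _) H; suff : false by [].
by apply: H; apply/existsP; exists j; rewrite eqxx.
Qed.

Lemma int_eq_0_or_N1 (f : int) : -2 < f -> f < 1 -> f = 0 \/ f = -1.
Proof. lia. Qed.

(** Let p be given by [first_large_derivative]. The earlier derivatives are below [c0 <= 1/2], so
    their floors are 0 or -1 and have weight 1, the later coordinates have weight 1 by definition,
    and the product for p collapses to a single power. Adding the nonnegative terms of all other p
    removes the dependence of the bound on which p occurs. *)
Lemma block_sum_le : exists2 C : R, 0 < C &
  forall q L N (k l : {ffun 'I_d -> 'I_L}) (t : R), (0 < q)%N -> (0 < L)%N -> l != k ->
  -1 <= t -> t + (N + d.+2)%:R / q%:R <= 2 ->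
  (N + d.+2)%:R / q%:R * (d * B * L)%:R <= c0 / 2 ->
  (d * B * L <= q)%N ->
  `|\sum_(0 <= a < N) cos (2 * pi * (q%:R *
       \sum_i ((k i)%:R - (l i)%:R) * F i 0%N (t + a%:R / q%:R)))| <=
  C * \sum_(p < d) q%:R `^ (1 - alpha p) *
     \prod_(i < d) floor_weight (alpha p) (d * B * L).+1 p i (floor_index (A t) B k l i).
Proof.
have /choice [CC HCC] : forall p : 'I_d, exists C : R, 0 < C /\
  forall phi (t q h c : R) N, 1 <= q -> 1 <= h -> c <= 1 / 2 ->
  (forall i y, t <= y <= t + (N + p.+2)%:R / q -> is_derive y 1 (phi i) (phi i.+1 y)) ->
  (forall i y, (0 < i <= p.+2)%N -> t <= y <= t + (N + p.+2)%:R / q -> `|phi i y - phi i t| <= c / 2) ->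
  c <= `|phi p.+2 t| ->
  h ^- p.+2 <= q * (q ^- p.+2 * (`|phi p.+2 t| / 2)) ->
  `|\sum_(0 <= a < N) cos (2 * pi * (q * phi 0%N (t + a%:R / q)))| <= C * h.
  by move=> p; have [//|C C1 C2] := block_bound R (k := p.+2); exists C.
have CC0 p : 0 < CC p by have [] := HCC p.
have S0 : 0 < \sum_p CC p.
  rewrite (bigD1 (Ordinal d_gt0)) //= ltr_wpDr // sumr_ge0 // => p _; exact: ltW.
exists ((\sum_p CC p) * (6 / c0)); first by rewrite mulr_gt0 // divr_gt0.
move=> q L N k l t q0 L0 lk t1 t2 small dBL.
have c0p := c0_gt0; have c0h := c0_le.
have qR : 1 <= q%:R :> R by rewrite ler1n.
have q0R : 0 < q%:R :> R by rewrite ltr0n.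
pose x i : R := (k i)%:R - (l i)%:R.
pose phi i y := \sum_j x j * F j i y.
have len0 : 0 <= (N + d.+2)%:R / q%:R :> R by rewrite divr_ge0.
have t3 : -2 <= t <= 2 by apply/andP; split; lra.
have xL i : `|x i| <= L%:R.
  have ki : (k i)%:R <= L%:R :> R by rewrite ler_nat ltnW.
  have li : (l i)%:R <= L%:R :> R by rewrite ler_nat ltnW.
  have k0 : 0 <= (k i)%:R :> R by [].
  have l0 : 0 <= (l i)%:R :> R by [].
  by rewrite ler_norml; apply/andP; split; rewrite /x; lra.
have ex1 : exists i, 1 <= `|x i|.
  have [i ki] : exists i, l i != k i.
    apply/existsP; rewrite -negb_forall; apply: contra lk => /forallP H.
    by apply/eqP/ffunP => i; apply/eqP; exact: H.
  exists i; rewrite /x; have : (val (l i) != val (k i)) by [].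
  rewrite neq_ltn => /orP[] h.
    rewrite ger0_norm ?subr_ge0 ?ler_nat ?(ltnW h) // lerBrDr addrC natr1 ler_nat //.
  by rewrite distrC ger0_norm ?subr_ge0 ?ler_nat ?(ltnW h) // lerBrDr addrC natr1 ler_nat.
have [p [pP pmin]] := first_large_derivative t3 ex1.
have Abnd i j : `|A t i j| <= B%:R.
  by apply: F_bound => //; rewrite ltnS ltnS; exact: ltnW.
have dphi i y : t <= y <= t + (N + d.+2)%:R / q%:R -> is_derive y 1 (phi i) (phi i.+1 y).
  move=> /andP[y1 y2]; rewrite /phi.
  have -> : (fun y => \sum_j x j * F j i y) = \sum_j (fun y => x j * F j i y).
    by apply/funext => z; rewrite fct_sumE.
  apply: is_derive_sum => j.
  have : is_derive y 1 (F j i) (F j i.+1 y) by apply: F_derive; apply/andP; split; lra.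
  by move=> H; exact: (is_deriveZ (x j)).
have var i y : (0 < i <= d.+1)%N -> t <= y <= t + (N + d.+2)%:R / q%:R ->
    `|phi i y - phi i t| <= c0 / 2.
  move=> /andP[i0 id] /andP[y1 y2].
  have [c /andP[c1 c2] ->] : exists2 c, t <= c <= y & phi i y - phi i t = phi i.+1 c * (y - t).
    apply: mean_value => // z /andP[z1 z2]; apply: dphi; apply/andP; split; lra.
  rewrite normrM (ger0_norm (x := y - t)) ?subr_ge0 // mulrC.
  apply: le_trans small; apply: ler_pM => //; [by rewrite subr_ge0|lra|].
  have := phase_derive_le (k := i.+1) (y := c) _ _ xL.
  rewrite ltnS id => /(_ isT) H; rewrite mulnAC natrM natrM; apply: H.
  by apply/andP; split; lra.
set v := `|phi p.+2 t| in pP *.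
have vd : v <= (d * B * L)%:R.
  have := phase_derive_le (k := p.+2) (y := t) _ _ xL.
  rewrite ltnS ltnS (ltnW (ltn_ord p)) => /(_ isT t3).
  by rewrite mulnAC natrM natrM.
have len p0 : (p0 < d)%N -> (N + p0.+2)%:R / q%:R <= (N + d.+2)%:R / q%:R :> R.
  by move=> pd; rewrite ler_pM2r ?invr_gt0 // ler_nat leq_add2l ltnS ltnS ltnW.
set z := Num.floor (\sum_i x i * A t i p).
set Z : R := `|z%:~R| + 1.
have Z1 : 1 <= Z by rewrite /Z lerDr.
(* The size [v] of the derivative is replaced by its floor: [v >= c0 / 3 * Z] holds for every floor,
   the factor [c0] being needed for the floors 0 and -1. *)
pose w := c0 / 6 * Z.
have wv : w <= v / 2.
  have /andP[] := floor_itv (\sum_i x i * A t i p); rewrite -/z intrD mulr1z => z1 z2.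
  have : c0 / 3 * Z <= v; last by rewrite /w; lra.
  have zcase : [\/ (z%:~R : R) = 0, (z%:~R : R) = -1, 1 <= (z%:~R : R) | (z%:~R : R) <= -2].
    have : [\/ z = 0, z = -1, 1 <= z | z <= -2] by case: z {z1 z2 Z Z1 w} => [[|n]|[|n]]; [constructor 1|constructor 3|constructor 2|constructor 4].
    case=> [->|->|h|h]; [by constructor 1|by constructor 2; rewrite rmorphN1|constructor 3|constructor 4].
      by rewrite (ler_int R 1).
    by rewrite (ler_int R _ (-2)).
  move: z1 z2 pP; rewrite /v /Z; set s := \sum_i _ => z1 z2 pP.
  have {}pP : c0 <= `|s| by exact: pP.
  change (c0 / 3 * (`|z%:~R| + 1) <= `|s|).
  move: (z%:~R : R) zcase z1 z2 => y.
  case=> [->|->|y1|y2] z1 z2.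
  - rewrite normr0; move: c0_gt0 pP; lra.
  - rewrite normrN normr1; move: c0_gt0 pP; lra.
  - rewrite (ger0_norm (x := y)); last lra.
    rewrite ger0_norm; last lra.
    have : c0 * (y + 1) <= 1 / 2 * (y + 1) by apply: ler_wpM2r => //; lra.
    lra.
  - rewrite (ler0_norm (x := y)); last lra.
    rewrite ler0_norm; last lra.
    have : c0 * (- y + 1) <= 1 / 2 * (- y + 1) by apply: ler_wpM2r => //; lra.
    lra.
have Z0 : 0 < Z by apply: lt_le_trans Z1.
have c06 : 0 < c0 / 6 by apply: divr_gt0 => //; rewrite ltr0n.
have w0 : 0 < w by exact: mulr_gt0.
have ZE : Z = `|z%:~R| + 1 by [].
clearbody Z.
have /andP[al0 al1] := alpha_bounds p.
have rootk (y : R) : 0 <= y -> (y `^ alpha p) ^+ p.+2 = y.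
  by move=> y0; rewrite -powR_mulrn ?powR_ge0 // -powRrM /alpha mulVf ?powRr1 // pnatr_eq0.
(* Chosen so that [h ^- p.+2 = q * (q ^- p.+2 * w)], the lower bound required by [block_bound] with
   [w <= v / 2]. That [h >= 1] follows from [w <= v <= d * B * L <= q]. *)
pose h := q%:R / (q%:R * w) `^ alpha p.
have qw0 : 0 < q%:R * w by rewrite mulr_gt0.
have r0 : 0 < (q%:R * w) `^ alpha p by rewrite powR_gt0.
have h1 : 1 <= h.
  rewrite /h ler_pdivlMr // mul1r.
  have qE : q%:R = (q%:R ^+ p.+2) `^ alpha p :> R.
    by rewrite -powR_mulrn // -powRrM /alpha divff ?powRr1 // pnatr_eq0.
  rewrite [leRHS]qE.
  apply: ge0_ler_powR; [exact: ltW|by rewrite nnegrE ltW|by rewrite nnegrE exprn_ge0|].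
  rewrite !exprS ler_pM2l //; apply: (le_trans (y := q%:R)).
    have : (d * B * L)%:R <= q%:R :> R by rewrite ler_nat.
    have : 0 <= v by exact: normr_ge0.
    move: wv vd; lra.
  by rewrite ler_peMr ?exprn_ege1 // ltW.
have prodE : \prod_(i < d) floor_weight (alpha p) (d * B * L).+1 p i (floor_index (A t) B k l i) = Z `^ (- alpha p).
  rewrite (bigD1 p) //= big1 ?mulr1.
    by rewrite /floor_weight ltnn eqxx floor_indexE // addrK ZE.
  move=> i ip; rewrite /floor_weight; case: ifP => ilp; last by rewrite val_eqE (negbTE ip).
  have := pmin i ilp; have := floor_indexE Abnd k l i.
  have /andP[] := floor_itv (dual_coord (A t) k l i); rewrite intrD mulr1z.
  set f := Num.floor _ => f1 f2 E; rewrite ltr_norml => /andP[s1 s2].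
  have {}f1 : (f%:~R : R) < 1 by apply: (le_lt_trans f1); apply: (lt_trans s2); lra.
  have {}f2 : -2 < (f%:~R : R).
    have : - c0 < f%:~R + 1 by apply: (lt_trans s1).
    lra.
  have {}f1 : f < 1 by rewrite -(ltr_int R).
  have {}f2 : -2 < f by rewrite -(ltr_int R).
  have fE := int_eq_0_or_N1 f2 f1.
  case: fE E => -> E.
    suff -> : floor_index (A t) B k l i = (d * B * L).+1 by rewrite eqxx orbT.
    by apply/eqP; rewrite -(eqr_nat R) E add0r.
  suff -> : floor_index (A t) B k l i = (d * B * L)%N by rewrite eqxx.
  by apply/eqP; rewrite -(eqr_nat R) E -natr1; apply/eqP; rewrite rmorphN1; ring.
have [_ /(_ phi t q%:R h c0 N qR h1 c0_le) HH] := HCC p.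
apply: (le_trans (HH _ _ _ _)).
- by move=> i y /andP[y1 y2]; apply: dphi; rewrite y1 (le_trans y2) // lerD2l len.
- move=> i y /andP[i0 ip] /andP[y1 y2]; apply: var.
    by rewrite i0 /=; apply: (leq_trans ip); rewrite ltnS; exact: (ltn_ord p).
  by rewrite y1 (le_trans y2) // lerD2l len.
- exact: pP.
- rewrite /h exprMn exprVn rootk; last exact: ltW.
  rewrite invfM invrK -/v.
  have -> : q%:R ^- p.+2 * (q%:R * w) = q%:R * (q%:R ^- p.+2 * w) by ring.
  apply: ler_wpM2l; first exact: ltW.
  by apply: ler_wpM2l; rewrite // invr_ge0 exprn_ge0 // ltW.
set X := \sum_p CC p in S0 *.
apply: (le_trans (y := X * (6 / c0) * (q%:R `^ (1 - alpha p) * Z `^ (- alpha p)))); last first.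
  apply: ler_wpM2l.
    by rewrite mulr_ge0 // ?ltW // divr_gt0.
  rewrite (bigD1 p) //= prodE lerDl sumr_ge0 // => j _; rewrite mulr_ge0 ?powR_ge0 //.
  by apply: prodr_ge0 => i _; exact: floor_weight_ge0.
have -> : h = q%:R `^ (1 - alpha p) * Z `^ (- alpha p) * (6 / c0) `^ alpha p.
  have E1 : (c0 / 6) `^ alpha p = ((6 / c0) `^ alpha p)^-1.
    have -> : c0 / 6 = (6 / c0)^-1 by rewrite invf_div.
    have c60 : 0 <= 6 / c0 by rewrite divr_ge0 // ltW.
    by rewrite -powR_inv1 // -powRrM mulN1r powRN.
  have E2 : (q%:R * w) `^ alpha p = q%:R `^ alpha p * (((6 / c0) `^ alpha p)^-1 * Z `^ alpha p).
    rewrite powRM; [|exact: ltW|exact: ltW].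
    by rewrite /w powRM ?E1 //; exact: ltW.
  rewrite /h E2 !powRN powRD; last by rewrite (gt_eqF q0R) /= implybT.
  rewrite powRr1 // powRN; field.
  have c6 : 0 < 6 / c0 by rewrite divr_gt0.
  by rewrite !gt_eqF // powR_gt0.
set Y := q%:R `^ _ * _; have Y0 : 0 <= Y by rewrite mulr_ge0 // powR_ge0.
have s1 : CC p <= X.
  by rewrite /X (bigD1 p) //= lerDl sumr_ge0 // => j _; exact: ltW.
have s2 : (6 / c0) `^ alpha p <= 6 / c0.
  by apply: ler1_powR; [rewrite ler_pdivlMr //; lra|lra].
rewrite -mulrA (mulrC (6 / c0)); apply: ler_pM => //.
- exact: ltW.
- by rewrite mulr_ge0 // powR_ge0.
- exact: ler_wpM2l.
Qed.

Lemma dual_weight_le (q L : nat) (p : 'I_d) (k : {ffun 'I_d -> 'I_L}) (t : R) :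
  (0 < L)%N -> -2 <= t <= 2 ->
  \sum_(l : {ffun 'I_d -> 'I_L})
    \prod_(i < d) floor_weight (alpha p) (d * B * L).+1 p i (floor_index (A t) B k l i)
  <= (C0.+1 ^ d)%:R * (4 * 2 ^+ d.-1) * (2 * d%:R * B%:R) ^+ d *
     (L%:R ^+ (d - p.+1) * L%:R `^ (1 - alpha p)).
Proof.
move=> L0 t2.
have Abnd i j : `|A t i j| <= B%:R.
  by apply: F_bound => //; rewrite ltnS ltnS; exact: ltnW.
have al : 0 < alpha p <= 1 / 2.
  rewrite /alpha invr_gt0 ltr0n /= div1r lef_pV2 ?posrE ?ltr0n //.
  by rewrite (ler_nat _ 2).
apply: (le_trans (sum_dual_weight Abnd (fun x s => @F_nondeg t x s t2) k p al)).
rewrite natrX -!mulrA; apply: ler_wpM2l; first by rewrite exprn_ge0.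
apply: ler_wpM2l => //; apply: ler_wpM2l; first by rewrite exprn_ge0.
set b := 2 * (d%:R * B%:R) : R.
have dR : 1 <= d%:R :> R by rewrite ler1n.
have BR : 1 <= B%:R :> R by rewrite ler1n.
have LR : 1 <= L%:R :> R by rewrite ler1n.
have dB1 : 1 <= d%:R * B%:R :> R by rewrite -natrM ler1n muln_gt0 d_gt0.
have b1 : 1 <= b by rewrite /b; move: dB1; lra.
have b0 : 0 <= b by apply: le_trans b1.
have L0' : 0 <= L%:R :> R by [].
have Mb : (d * B * L).+1%:R <= b * L%:R :> R.
  rewrite -natr1 !natrM /b.
  have : 1 <= d%:R * B%:R * L%:R :> R by rewrite -!natrM ler1n !muln_gt0 d_gt0 B_gt0.
  lra.
have e : (d = (d - p.+1) + 1 + p)%N by move: (ltn_ord p); clear; lia.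
apply: (le_trans (y := (b * L%:R) ^+ (d - p.+1) * (b * L%:R) `^ (1 - alpha p))).
  apply: ler_pM; rewrite ?exprn_ge0 ?powR_ge0 //.
    by apply: lerXn2r; rewrite ?nnegrE ?mulr_ge0.
  have /andP[a0 a1] := al.
  by apply: ge0_ler_powR; rewrite ?nnegrE ?mulr_ge0 //; lra.
rewrite powRM // exprMn mulrACA; apply: ler_wpM2r.
  by rewrite mulr_ge0 ?exprn_ge0 ?powR_ge0.
rewrite [in leRHS]e exprD exprD expr1 -mulrA; apply: ler_wpM2l; first by rewrite exprn_ge0.
rewrite -[leLHS]mulr1; apply: ler_pM; rewrite ?powR_ge0 ?exprn_ege1 //.
apply: ler1_powR => //; have /andP[a0 a1] := al; lra.
Qed.

(** On each block the sum over [l] and the sum over p are exchanged, so that [dual_weight_le]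
    applies at the base point of the block, uniformly in [k]. *)
Lemma frequency_sum_le (D : nat) :
  (forall p, (p < d)%N -> (p.+2 * (d - p).+1 <= D.+1)%N) ->
  forall eta : R, 0 < eta -> exists2 eps : R, 0 < eps &
  forall q L (k : {ffun 'I_d -> 'I_L}), (0 < q)%N -> (0 < L)%N ->
  L%:R ^+ D <= eps * q%:R ->
  \sum_(l | l != k) `|\sum_(0 <= a < (2 * q).+1) cos (2 * pi * (q%:R *
      \sum_i ((k i)%:R - (l i)%:R) * F i 0%N (a%:R / q%:R - 1)))| <= eta * q%:R.
Proof.
move=> HD eta eta0.
have [C C_gt0 HC] := block_sum_le.
have dR : 1 <= d%:R :> R by rewrite ler1n.
have BR : 1 <= B%:R :> R by rewrite ler1n.
have dB1 : 1 <= d%:R * B%:R :> R by rewrite -natrM ler1n muln_gt0 d_gt0.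
have c_gt0 := c0_gt0; have c_le := c0_le.
move: HC c_gt0 c_le; move: (c0) => c HC c_gt0 c_le.
(* Blocks have about [c1 * q / L] points. With the overhang of [d + 2] points, a block has parameter
   length at most [2 * c1 / L], and derivatives bounded by [d * B * L] vary on it by at most
   [c / 2]. *)
pose c1 : R := c / (4 * (d%:R * B%:R)).
have c1p : 0 < c1 by rewrite divr_gt0 // mulr_gt0 // (lt_le_trans _ dB1).
have c1E : c1 * (d%:R * B%:R) = c / 4.
  by rewrite /c1; field; rewrite !gt_eqF // (lt_le_trans ltr01).
have c1h : c1 <= 1 / 8 by have : c1 <= c1 * (d%:R * B%:R); [rewrite ler_peMr // ltW|lra].
pose G : R := (C0.+1 ^ d)%:R * (4 * 2 ^+ d.-1) * (2 * d%:R * B%:R) ^+ d.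
have Gp : 0 < G.
  apply: mulr_gt0; last by rewrite exprn_gt0 // mulr_gt0 ?ltr0n // mulr_gt0 ?ltr0n.
  by apply: mulr_gt0; [rewrite ltr0n expn_gt0|rewrite mulr_gt0 // exprn_gt0].
(* At most [7 / c1 * L] blocks, the constants [C] and [G] of the bound on one block, and d values of
   p. *)
pose T := 7 / c1 * C * G * d%:R.
have Tp : 0 < T.
  apply: mulr_gt0; last by rewrite ltr0n.
  by apply: mulr_gt0 => //; apply: mulr_gt0 => //; rewrite divr_gt0.
(* The last entry makes [c1 * q / L] at least [d + 3], so that the overhang is no longer than a
   block. *)
pose e : R := Num.min 1 (Num.min (eta / T) (c1 / (d.+3)%:R)).
have e0 : 0 < e by rewrite /e !lt_min ltr01 /=; apply/andP; split; apply: divr_gt0.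
have e1 : e <= 1 by rewrite /e ge_min lexx.
have e2 : e <= eta / T by rewrite /e !ge_min lexx orbT.
have e3 : e <= c1 / d.+3%:R by rewrite /e !ge_min lexx !orbT.
clearbody e.
exists (e ^+ d.+1) => [|q L k q0 L0 LD]; first by rewrite exprn_gt0.
have qR : 0 < q%:R :> R by rewrite ltr0n.
have LR : 1 <= L%:R :> R by rewrite ler1n.
have LR0 : 0 < L%:R :> R by rewrite ltr0n.
have D0 : (0 < D)%N by move: (HD 0%N d_gt0) d_gt0; rewrite subn0; clear; lia.
have Lq : L%:R * d.+3%:R <= c1 * q%:R.
  rewrite -ler_pdivlMr ?ltr0n // mulrAC.
  apply: (le_trans (y := e * q%:R)); last by rewrite ler_pM2r.
  apply: (le_trans (y := L%:R ^+ D)); first exact: ler_eXnr.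
  apply: (le_trans LD); have e0' := ltW e0.
  by rewrite ler_pM2r // exprS ler_piMr // exprn_ile1.
pose x : R := c1 * q%:R / L%:R.
have x_ge : d.+3%:R <= x by rewrite /x ler_pdivlMr // mulrC.
have d3 : 3 <= d.+3%:R :> R by rewrite ler_nat.
pose b := Num.truncn x.
have /andP[bx xb] : b%:R <= x < b.+1%:R by apply: truncn_itv; lra.
have xb2 : x / 2 <= b%:R by move: xb; rewrite -natr1; lra.
have b0 : (0 < b)%N by rewrite -(ltr0n R); lra.
have q3 : d.+3%:R <= q%:R :> R.
  have : d.+3%:R <= L%:R * d.+3%:R :> R by rewrite ler_peMl.
  have : c1 * q%:R <= 1 / 8 * q%:R by rewrite ler_pM2r.
  lra.
have dBLq : (d * B * L <= q)%N.
  rewrite -(ler_nat R) !natrM -(ler_pM2l c1p) mulrA c1E.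
  have : L%:R <= L%:R * d.+3%:R :> R by rewrite ler_peMr //; lra.
  have : c * L%:R <= 1 / 2 * L%:R by rewrite ler_pM2r.
  lra.
pose K := ((2 * q).+1 %/ b).+1.
have NK : ((2 * q).+1 <= K * b)%N by apply: ltnW; rewrite /K; exact: ltn_ceil.
have KL : K%:R <= 7 / c1 * L%:R.
  have h1 : ((2 * q).+1 %/ b)%:R * b%:R <= 3 * q%:R :> R.
    by rewrite -!natrM ler_nat (leq_trans (leq_trunc_div _ _)) //; move: q0; clear; lia.
  have h2 : ((2 * q).+1 %/ b)%:R * x <= 6 * q%:R.
    have : ((2 * q).+1 %/ b)%:R * (x / 2) <= ((2 * q).+1 %/ b)%:R * b%:R by rewrite ler_wpM2l.
    lra.
  have xp : 0 < x by lra.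
  have h3 : ((2 * q).+1 %/ b)%:R <= 6 / c1 * L%:R.
    rewrite -(ler_pM2r xp); apply: (le_trans h2).
    by rewrite le_eqVlt /x; apply/orP; left; apply/eqP; field; rewrite !gt_eqF.
  have h4 : 1 <= 1 / c1 * L%:R.
    rewrite mulrC mulrA mulr1 ler_pdivlMr // mul1r; lra.
  by rewrite /K -natr1; lra.
pose t (m : nat) : R := (m * b)%:R / q%:R - 1.
pose X (p : 'I_d) := q%:R `^ (1 - alpha p) * (L%:R ^+ (d - p.+1) * L%:R `^ (1 - alpha p)).
have blk m : \sum_(l | l != k) `|\sum_(0 <= r < minn b ((2 * q).+1 - m * b))
    cos (2 * pi * (q%:R * \sum_i ((k i)%:R - (l i)%:R) * F i 0%N (t m + r%:R / q%:R)))|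
    <= C * G * \sum_p X p.
  have X0 : 0 <= \sum_p X p.
    by apply: sumr_ge0 => p _; rewrite !mulr_ge0 ?powR_ge0 ?exprn_ge0.
  set N := minn _ _.
  (* A block past the end is empty; it is set aside because its base point may leave [-2, 2]. *)
  have [->|N0] := eqVneq N 0%N.
    rewrite big1; last by move=> l _; rewrite big_geq // normr0.
    by rewrite mulr_ge0 // mulr_ge0 // ltW.
  have mb : (m * b + N <= (2 * q).+1)%N by move: N0; rewrite /N; clear; lia.
  have t1 : -1 <= t m by rewrite /t lerBrDr addrC subrr divr_ge0.
  (* The overhang goes beyond the parameter 1 by at most (d + 3) / q <= 1. *)
  have t2 : t m + (N + d.+2)%:R / q%:R <= 2.
    rewrite /t addrAC -mulrDl -natrD lerBlDr ler_pdivrMr //.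
    have : (m * b + (N + d.+2))%:R <= ((2 * q).+1 + d.+2)%:R :> R by rewrite ler_nat addnA leq_add2r.
    move/le_trans; apply; rewrite -addn1 -addnA add1n natrD natrM; lra.
  have t3 : -2 <= t m <= 2.
    apply/andP; split; first lra.
    have : 0 <= (N + d.+2)%:R / q%:R :> R by rewrite divr_ge0.
    lra.
  apply: (le_trans (y := \sum_(l : {ffun 'I_d -> 'I_L}) C * \sum_(p < d) q%:R `^ (1 - alpha p) *
     \prod_(i < d) floor_weight (alpha p) (d * B * L).+1 p i (floor_index (A (t m)) B k l i))).
    rewrite [leLHS]big_mkcond /=; apply: ler_sum => l _; case: ifP => [lk|_].
      apply: HC => //.
      have len : (N + d.+2)%:R / q%:R * L%:R <= 2 * c1.
        rewrite mulrAC ler_pdivrMr //.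
        have : (N + d.+2)%:R <= 2 * x.
          rewrite natrD; have : N%:R <= b%:R :> R by rewrite ler_nat geq_minl.
          have : d.+2%:R <= d.+3%:R :> R by rewrite ler_nat.
          lra.
        rewrite -(ler_pM2r LR0) => /le_trans; apply.
        by rewrite le_eqVlt /x; apply/orP; left; apply/eqP; field; rewrite gt_eqF.
      rewrite !natrM [_ * L%:R]mulrC mulrA.
      apply: (le_trans (y := 2 * c1 * (d%:R * B%:R))).
        by apply: ler_wpM2r => //; rewrite mulr_ge0.
      by rewrite -mulrA c1E; lra.
    rewrite mulr_ge0 ?(ltW C_gt0) // sumr_ge0 // => p _; rewrite mulr_ge0 ?powR_ge0 //.
    by apply: prodr_ge0 => i _; exact: floor_weight_ge0.
  rewrite -mulr_sumr exchange_big /= -mulrA; apply: ler_wpM2l; first exact: ltW.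
  rewrite mulr_sumr; apply: ler_sum => p _; rewrite -mulr_sumr /X mulrCA.
  apply: ler_wpM2l; first exact: powR_ge0.
  exact: dual_weight_le.
apply: (le_trans (y := \sum_(l | l != k) \sum_(m < K) `|\sum_(0 <= r < minn b ((2 * q).+1 - m * b))
    cos (2 * pi * (q%:R * \sum_i ((k i)%:R - (l i)%:R) * F i 0%N (t m + r%:R / q%:R)))|)).
  apply: ler_sum => l _.
  have := sum_blocks_le (fun a => cos (2 * pi * (q%:R *
      \sum_i ((k i)%:R - (l i)%:R) * F i 0%N (a%:R / q%:R - 1)))) (2 * q).+1 b K.
  have /minn_idPl -> := NK.
  move=> /le_trans; apply; rewrite le_eqVlt; apply/orP; left; apply/eqP.
  apply: eq_bigr => m _; congr (`| _ |); apply: eq_bigr => r _.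
  congr (cos (_ * (_ * _))); apply: eq_bigr => i _; congr (_ * F i 0%N _).
  by rewrite /t natrD mulrDl addrAC.
rewrite exchange_big /=.
apply: (le_trans (ler_sum _ (fun m _ => blk (val m)))).
rewrite sumr_const card_ord -[leLHS]mulr_natl.
apply: (le_trans (y := 7 / c1 * L%:R * (C * G * \sum_p X p))).
  apply: ler_wpM2r => //; rewrite !mulr_ge0 ?(ltW C_gt0) ?(ltW Gp) // sumr_ge0 // => p _.
  by rewrite !mulr_ge0 ?powR_ge0 ?exprn_ge0.
have XS : L%:R * \sum_p X p <= d%:R * (e * q%:R).
  rewrite mulr_sumr; apply: (le_trans (y := \sum_(p < d) e * q%:R)).
    apply: ler_sum => p _; apply: (frequency_term_le (D := D)) => //; last exact: HD.
    by rewrite e0.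
  by rewrite sumr_const card_ord -[_ *+ _]mulr_natl.
apply: (le_trans (y := 7 / c1 * C * G * (d%:R * (e * q%:R)))).
  have -> : 7 / c1 * L%:R * (C * G * \sum_p X p) = 7 / c1 * C * G * (L%:R * \sum_p X p) by ring.
  apply: ler_wpM2l => //; rewrite !mulr_ge0 ?(ltW C_gt0) ?(ltW Gp) //.
  by rewrite invr_ge0 ltW.
have -> : 7 / c1 * C * G * (d%:R * (e * q%:R)) = T * e * q%:R by rewrite /T; ring.
by rewrite ler_pM2r // mulrC -ler_pdivlMr.
Qed.

End FrequencySum.

(** * Detecting integer points *)

Section QuadraticForm.
Variable R : realType.

(** The squared modulus of the sum of [c k] e^(i [th k]). *)
Definition trig_sqr (K : finType) (c th : K -> R) : R :=
  (\sum_k c k * cos (th k)) ^+ 2 + (\sum_k c k * sin (th k)) ^+ 2.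

Lemma trig_sqr_ge0 (K : finType) (c th : K -> R) : 0 <= trig_sqr c th.
Proof. by rewrite addr_ge0 // sqr_ge0. Qed.

Lemma trig_sqrE (K : finType) (c th : K -> R) :
  trig_sqr c th = \sum_k \sum_l c k * c l * cos (th k - th l).
Proof.
rewrite /trig_sqr !expr2 !big_distrlr /= -big_split; apply: eq_bigr => k _.
by rewrite -big_split; apply: eq_bigr => l _ /=; rewrite cosB; ring.
Qed.

(* Expanding the square, the diagonal contributes [N * sum c^2]; the rest is
   bounded by Schur's test. *)
Lemma sum_trig_sqr (K : finType) (c : K -> R) (th : nat -> K -> R) (N : nat) (E : R) :
  (forall k, \sum_(l | l != k) `|\sum_(0 <= a < N) cos (th a k - th a l)| <= E) ->
  `|\sum_(0 <= a < N) trig_sqr c (th a) - N%:R * \sum_k c k ^+ 2| <= E * \sum_k c k ^+ 2.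
Proof.
move=> HE.
pose S k l := \sum_(0 <= a < N) cos (th a k - th a l).
have SC k l : S k l = S l k by apply: eq_bigr => a _; rewrite -cosN opprB.
have -> : \sum_(0 <= a < N) trig_sqr c (th a) = \sum_k \sum_l c k * c l * S k l.
  under eq_bigr do rewrite trig_sqrE.
  rewrite exchange_big /=; apply: eq_bigr => k _.
  by rewrite exchange_big /=; apply: eq_bigr => l _; rewrite mulr_sumr.
have -> : \sum_k \sum_l c k * c l * S k l - N%:R * \sum_k c k ^+ 2 =
    \sum_k \sum_(l | l != k) c k * c l * S k l.
  rewrite mulr_sumr -sumrB; apply: eq_bigr => k _.
  rewrite (bigD1 k) //= addrAC.
  have -> : S k k = N%:R.
    rewrite /S; under eq_bigr do rewrite subrr cos0.
    by rewrite sumr_const_nat subn0.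
  by rewrite expr2 [N%:R * _]mulrC subrr add0r.
apply: (le_trans (ler_norm_sum _ _ _)).
apply: (le_trans (y := \sum_k \sum_(l | l != k) (c k ^+ 2 / 2 * `|S k l| + c l ^+ 2 / 2 * `|S k l|))).
  apply: ler_sum => k _; apply: (le_trans (ler_norm_sum _ _ _)); apply: ler_sum => l _.
  rewrite normrM -mulrDl; apply: ler_wpM2r => //; rewrite normrM.
  rewrite -(real_normK (num_real (c k))) -(real_normK (num_real (c l))).
  have := sqr_ge0 (`|c k| - `|c l|); lra.
have half : \sum_k \sum_(l | l != k) c k ^+ 2 / 2 * `|S k l| <= E * (\sum_k c k ^+ 2) / 2.
  rewrite mulr_sumr mulr_suml; apply: ler_sum => k _.
  rewrite -mulr_sumr (_ : E * c k ^+ 2 / 2 = c k ^+ 2 / 2 * E); last by ring.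
  by apply: ler_wpM2l; [rewrite divr_ge0 // sqr_ge0|exact: HE].
under eq_bigr do rewrite big_split /=.
rewrite big_split /=; apply: (le_trans (y := E * (\sum_k c k ^+ 2) / 2 + E * (\sum_k c k ^+ 2) / 2)); last lra.
apply: lerD => //.
have -> : \sum_k \sum_(l | l != k) c l ^+ 2 / 2 * `|S k l| = \sum_k \sum_(l | l != k) c k ^+ 2 / 2 * `|S k l|; last exact: half.
rewrite (exchange_big_dep xpredT) //=; apply: eq_bigr => l _.
by apply: eq_big => [k|k _]; [rewrite eq_sym|rewrite SC].
Qed.

Variable d : nat.

Definition pairing (L : nat) (k : {ffun 'I_d -> 'I_L}) (x : 'I_d -> R) : R :=
  2 * pi * \sum_i (k i)%:R * x i.

(** Replacing [x] by [x - z] changes every phase by a multiple of 2 pi and brings it into [-1, 1],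
    where the cosine is at least 1/2; there are [L ^ d] frequencies. *)
Lemma dirichlet_ge (L : nat) (x : 'I_d -> R) (z : 'I_d -> int) :
  (forall i, 2 * pi * d%:R * L%:R * `|x i - (z i)%:~R| <= 1) ->
  (L%:R ^+ d / 2) ^+ 2 <= trig_sqr (fun=> 1) (fun k : {ffun 'I_d -> 'I_L} => pairing k x).
Proof.
move=> H; rewrite /trig_sqr.
apply: (le_trans (y := (\sum_(k : {ffun 'I_d -> 'I_L}) 1 * cos (pairing k x)) ^+ 2)); last first.
  by rewrite lerDl sqr_ge0.
have L0 : 0 <= L%:R ^+ d / 2 :> R by rewrite divr_ge0 // exprn_ge0.
suff H1 : L%:R ^+ d / 2 <= \sum_(k : {ffun 'I_d -> 'I_L}) 1 * cos (pairing k x).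
  by apply: lerXn2r; rewrite ?nnegrE // (le_trans L0).
have half (k : {ffun 'I_d -> 'I_L}) : 1 / 2 <= cos (pairing k x).
  have -> : cos (pairing k x) = cos (2 * pi * \sum_i (k i)%:R * (x i - (z i)%:~R)).
    rewrite -[RHS](cosD2piz _ (\sum_i (k i)%:Z * z i)); congr cos.
    rewrite /pairing rmorph_sum /= -mulrDr -big_split /=; congr (_ * _).
    by apply: eq_bigr => i _; rewrite rmorphM /=; ring.
  apply: cos_ge_half.
  have p0 : 0 < 2 * pi :> R by rewrite mulr_gt0 // pi_gt0.
  rewrite normrM (gtr0_norm p0).
  case: (posnP d) => [d0|d0].
    rewrite big1 ?normr0 ?mulr0 ?ler01 // => i _.
    by exfalso; move: (leq_ltn_trans (leq0n _) (ltn_ord i)); rewrite d0.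
  apply: (le_trans (y := 2 * pi * \sum_(i < d) (2 * pi * d%:R)^-1)); last first.
    rewrite sumr_const card_ord -[X in _ * X <= _]mulr_natl.
    have pz : pi != 0 :> R by rewrite gt_eqF // pi_gt0.
    have dz : d%:R != 0 :> R by rewrite pnatr_eq0 -lt0n.
    by rewrite le_eqVlt; apply/orP; left; apply/eqP; rewrite mulrA mulfV // !mulf_neq0.
  rewrite ler_pM2l //; apply: (le_trans (ler_norm_sum _ _ _)); apply: ler_sum => i _.
  rewrite normrM ger0_norm //.
  have dp : 0 < 2 * pi * d%:R :> R by rewrite mulr_gt0 // ltr0n.
  rewrite -[leRHS]mul1r ler_pdivlMr // mulrC.
  apply: le_trans (H i); rewrite -!mulrA; do 2 apply: ler_wpM2l => //.
    exact: pi_ge0.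
  apply: ler_wpM2l => //; apply: ler_wpM2r => //; rewrite ler_nat.
  exact: ltnW.
apply: (le_trans (y := \sum_(k : {ffun 'I_d -> 'I_L}) 1 / 2)).
  rewrite sumr_const card_ffun !card_ord.
  by rewrite -[leRHS]mulr_natl natrX mul1r.
by apply: ler_sum => k _; rewrite [leRHS]mul1r; exact: half.
Qed.

End QuadraticForm.

(** * The tent kernel and the lower bound for the number of near-integral points *)

Section TentKernel.
Variables (R : realType) (d M : nat).
Hypothesis M_gt0 : (0 < M)%N.
Hypothesis d_gt0 : (0 < d)%N.
Let L := (4 * M).+1.

Definition tent (m : 'I_L) : R := (minn m (4 * M - m))%:R.

Lemma sum_tent_sqr_ge : 2 * M%:R ^+ 3 <= \sum_m tent m ^+ 2.
Proof.
rewrite /tent -(big_mkord xpredT (fun m => (minn m (4 * M - m))%:R ^+ 2)).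
have h1 : (M <= 3 * M)%N by move: M_gt0; clear; lia.
have h2 : (3 * M <= L)%N by rewrite /L; clear; lia.
rewrite (big_cat_nat (n := M)) //=; last by rewrite (leq_trans h1).
rewrite (big_cat_nat (n := 3 * M) (p := L)) //=.
apply: (le_trans (y := \sum_(M <= m < 3 * M) M%:R ^+ 2)).
  rewrite sumr_const_nat -[leRHS]mulr_natl -natrX -natrM -natrX -natrM ler_nat.
  by rewrite !expnS; clear; nia.
rewrite -[leLHS]add0r; apply: lerD; first by apply: sumr_ge0 => m _; exact: sqr_ge0.
rewrite -[leLHS]addr0; apply: lerD; last by apply: sumr_ge0 => m _; exact: sqr_ge0.
apply: ler_sum_nat => m /andP[m1 m2]; apply: lerXn2r; rewrite ?nnegrE // ler_nat.
by move: m1 m2; clear; lia.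
Qed.

Lemma sum_tent_le : \sum_m tent m <= 10 * M%:R ^+ 2.
Proof.
apply: (le_trans (y := \sum_(m < L) (2 * M)%:R)).
  by apply: ler_sum => m _; rewrite /tent ler_nat; clear; lia.
rewrite sumr_const card_ord -[leLHS]mulr_natl -natrX -!natrM ler_nat /L.
by move: M_gt0; rewrite !expnS; clear; nia.
Qed.

Lemma sum_tent_diff_le : \sum_m (tent (ordS m) - tent m) ^+ 2 <= 5 * M%:R.
Proof.
apply: (le_trans (y := \sum_(m < L) 1)); last first.
  by rewrite sumr_const card_ord -natrM ler_nat /L; move: M_gt0; clear; lia.
apply: ler_sum => m _; rewrite -real_normK ?num_real // expr_le1 ?normr_ge0 //.
have mL := ltn_ord m; rewrite /tent /=.
have [e|ne] := eqVneq (val m) (4 * M)%N.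
  have -> : (m.+1 %% L = 0)%N by rewrite e modnn.
  by rewrite e subnn minn0 min0n subrr normr0.
have {}mL : (m < 4 * M)%N by rewrite ltn_neqAle ne -ltnS.
rewrite modn_small; last by rewrite /L ltnS.
set a := minn _ _; set b := minn _ _.
have ab : (a <= b.+1)%N by rewrite /a /b; move: mL; clear; lia.
have ba : (b <= a.+1)%N by rewrite /a /b; move: mL; clear; lia.
move: ab ba; rewrite -!(ler_nat R) -!natr1 ler_norml => ? ?.
by apply/andP; split; lra.
Qed.

Definition tent_prod (k : {ffun 'I_d -> 'I_L}) : R := \prod_i tent (k i).

(** Cyclic, hence a bijection of the frequency box, so that reindexing creates no boundary terms. *)
Definition shift (i : 'I_d) (k : {ffun 'I_d -> 'I_L}) : {ffun 'I_d -> 'I_L} :=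
  [ffun j => if j == i then ordS (k j) else k j].
Definition unshift (i : 'I_d) (k : {ffun 'I_d -> 'I_L}) : {ffun 'I_d -> 'I_L} :=
  [ffun j => if j == i then ord_pred (k j) else k j].

Lemma shiftK i : cancel (shift i) (unshift i).
Proof. by move=> k; apply/ffunP => j; rewrite !ffunE; case: eqP => // _; rewrite ordSK. Qed.

Lemma unshiftK i : cancel (unshift i) (shift i).
Proof. by move=> k; apply/ffunP => j; rewrite !ffunE; case: eqP => // _; rewrite ord_predK. Qed.

Lemma sum_unshift i (G : {ffun 'I_d -> 'I_L} -> {ffun 'I_d -> 'I_L} -> R) :
  \sum_k G (unshift i k) k = \sum_k G k (shift i k).
Proof.
rewrite (reindex (shift i)) /=; last by exists (unshift i) => k _; rewrite ?shiftK ?unshiftK.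
by apply: eq_bigr => k _; rewrite shiftK.
Qed.

Definition tent_diff (i : 'I_d) (k : {ffun 'I_d -> 'I_L}) : R :=
  tent_prod k - tent_prod (unshift i k).

Lemma sum_tent_prod_sqr : \sum_k tent_prod k ^+ 2 = (\sum_m tent m ^+ 2) ^+ d.
Proof.
rewrite -[d in RHS]card_ord -prodr_const (bigA_distr_bigA (fun _ m => tent m ^+ 2)).
by apply: eq_bigr => k _; rewrite prodrXl.
Qed.

Lemma sum_tent_prod : \sum_k tent_prod k = (\sum_m tent m) ^+ d.
Proof.
by rewrite -[d in RHS]card_ord -prodr_const (bigA_distr_bigA (fun _ m => tent m)).
Qed.

Lemma sum_tent_diff_sqr i : \sum_k tent_diff i k ^+ 2 =
  (\sum_m (tent (ordS m) - tent m) ^+ 2) * (\sum_m tent m ^+ 2) ^+ d.-1.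
Proof.
rewrite (sum_unshift i (fun k k' => (tent_prod k' - tent_prod k) ^+ 2)).
pose f (j : 'I_d) (m : 'I_L) := if j == i then (tent (ordS m) - tent m) ^+ 2 else tent m ^+ 2.
transitivity (\sum_(k : {ffun 'I_d -> 'I_L}) \prod_j f j (k j)).
  apply: eq_bigr => k _; rewrite /tent_prod (bigD1 i) //= (bigD1 i (F := fun j => tent (k j))) //=.
  rewrite (bigD1 i (F := fun j => f j (k j))) //= /f eqxx ffunE eqxx.
  rewrite (eq_bigr (fun j => tent (k j))); last by move=> j ji; rewrite ffunE (negbTE ji).
  rewrite -mulrBl exprMn -prodrXl; congr (_ * _).
  by apply: eq_bigr => j ji; rewrite (negbTE ji).
rewrite -(bigA_distr_bigA f) (bigD1 i) //= /f eqxx; congr (_ * _).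
rewrite (eq_bigr (fun=> \sum_m tent m ^+ 2)); last by move=> j ji; rewrite (negbTE ji).
by rewrite prodr_const cardC1 card_ord.
Qed.

(* [W (1 - e(x_i))] is the trigonometric polynomial with coefficients [tent_diff i];
   the cyclic shift is harmless as the tent vanishes at its ends. *)
Lemma trig_sqr_tent_diff (i : 'I_d) (x : 'I_d -> R) :
  trig_sqr (tent_diff i) (fun k => pairing k x) =
  2 * (1 - cos (2 * pi * x i)) * trig_sqr tent_prod (fun k => pairing k x).
Proof.
have step (g : R -> R) (k : {ffun 'I_d -> 'I_L}) :
    tent_prod k * g (pairing (shift i k) x) = tent_prod k * g (pairing k x + 2 * pi * x i).
  have [e|ne] := eqVneq (val (k i)) (4 * M)%N.
    by rewrite /tent_prod (bigD1 i) //= {1 3}/tent e subnn minn0 !mul0r.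
  have kL : (k i < 4 * M)%N by rewrite ltn_neqAle ne -ltnS ltn_ord.
  congr (_ * g _); rewrite /pairing -mulrDr; congr (_ * _).
  rewrite (bigD1 i) //= (bigD1 i (F := fun j => (k j)%:R * x j)) //= ffunE eqxx /= modn_small ?ltnS // -natr1.
  rewrite (eq_bigr (fun j => (k j)%:R * x j)).
    by rewrite mulrDl mul1r addrAC.
  by move=> j ji; rewrite ffunE (negbTE ji).
have sub (g : R -> R) : \sum_k tent_diff i k * g (pairing k x) =
    \sum_k tent_prod k * g (pairing k x) - \sum_k tent_prod k * g (pairing k x + 2 * pi * x i).
  under eq_bigr do rewrite mulrBl.
  rewrite sumrB (sum_unshift i (fun k k' => tent_prod k * g (pairing k' x))).
  by under [X in _ - X = _]eq_bigr do rewrite step.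
rewrite /trig_sqr !sub; set C := cos (2 * pi * x i); set S := sin (2 * pi * x i).
have -> : \sum_k tent_prod k * cos (pairing k x + 2 * pi * x i) =
    (\sum_k tent_prod k * cos (pairing k x)) * C - (\sum_k tent_prod k * sin (pairing k x)) * S.
  rewrite !mulr_suml -sumrB; apply: eq_bigr => k _; rewrite cosD -/C -/S; ring.
have -> : \sum_k tent_prod k * sin (pairing k x + 2 * pi * x i) =
    (\sum_k tent_prod k * sin (pairing k x)) * C + (\sum_k tent_prod k * cos (pairing k x)) * S.
  rewrite !mulr_suml -big_split; apply: eq_bigr => k _ /=; rewrite sinD -/C -/S; ring.
have CS : S ^+ 2 = 1 - C ^+ 2 by exact: sin2cos2.
by ring: CS.
Qed.

(** Let W be the kernel and dev the sum of the 1 - cos(2 pi x_i). The average of W (eps - dev) is at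
    least half that of the main term of eps W: by [trig_sqr_tent_diff] the part with dev is a sum of
    kernels built from the tent differences, whose squares sum to O(M) against M^3 for the tent. As
    W (eps - dev) is positive only when dev < eps, and W is at most 2 [s1]^(2d), many a must satisfy
    dev < eps. The ratio of [s2]^d to [s1]^(2d) produces the power of 50 M. *)
Lemma tent_count (x : nat -> 'I_d -> R) (N : nat) (E : R) : E <= N%:R / 10 ->
  (forall k : {ffun 'I_d -> 'I_L}, \sum_(l | l != k)
     `|\sum_(0 <= a < N) cos (pairing k (x a) - pairing l (x a))| <= E) ->
  (N%:R / 4 / (50 * M%:R) ^+ d : R) <=
  \sum_(0 <= a < N) (\sum_i (1 - cos (2 * pi * x a i)) < 4 * d%:R / M%:R ^+ 2)%R%:R.
Proof.
move=> EN HE.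
(* The constant 4 gives d * 5M = (5/8) * eps * 2M^3, and 9/10 - (11/10)(5/8)/2 exceeds 1/2. *)
set eps := 4 * d%:R / M%:R ^+ 2.
have M0 : 0 < M%:R :> R by rewrite ltr0n.
have M1 : 1 <= M%:R :> R by rewrite ler1n.
have d0 : 0 < d%:R :> R by rewrite ltr0n.
have eps0 : 0 < eps by rewrite divr_gt0 ?exprn_gt0 // mulr_gt0.
have S2 := sum_tent_sqr_ge; have S1 := sum_tent_le; have Dt := sum_tent_diff_le.
set s2 := \sum_m tent m ^+ 2 in S2 *; set s1 := \sum_m tent m in S1 *.
set dt := \sum_m _ in Dt *.
have s2p : 0 < s2 by apply: lt_le_trans S2; rewrite mulr_gt0 // exprn_gt0.
have s1p : 0 <= s1 by apply: sumr_ge0 => m _.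
have N0 : 0 <= N%:R :> R by [].
pose W a := trig_sqr tent_prod (fun k => pairing k (x a)).
pose V i a := trig_sqr (tent_diff i) (fun k => pairing k (x a)).
pose dev a := \sum_i (1 - cos (2 * pi * x a i)).
have VW i a : V i a = 2 * (1 - cos (2 * pi * x a i)) * W a by exact: trig_sqr_tent_diff.
have TE a : eps * W a - (\sum_i V i a) / 2 = W a * (eps - dev a).
  rewrite /dev mulrBr [W a * eps]mulrC; congr (_ - _).
  rewrite mulr_sumr mulr_suml; apply: eq_bigr => i _; rewrite VW; by field.
have sumW : (N%:R - E) * s2 ^+ d <= \sum_(0 <= a < N) W a.
  have := sum_trig_sqr tent_prod (th := fun a k => pairing k (x a)) HE.
  rewrite sum_tent_prod_sqr -/s2 ler_norml => /andP[h _].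
  by move: h; rewrite lerBrDr => h; apply: le_trans h; rewrite mulrBl addrC.
have sumV : forall j, \sum_(0 <= a < N) V j a <= (N%:R + E) * (dt * s2 ^+ d.-1).
  move=> j; have := sum_trig_sqr (tent_diff j) (th := fun a k => pairing k (x a)) HE.
  rewrite sum_tent_diff_sqr -/s2 -/dt ler_norml => /andP[_ h].
  by move: h; rewrite lerBlDr => h; apply: (le_trans h); rewrite mulrDl addrC.
have s2d : s2 ^+ d = s2 * s2 ^+ d.-1 by rewrite -exprS prednK.
have sp : 0 < s2 ^+ d.-1 by rewrite exprn_gt0.
have E0 : - E <= N%:R / 10.
  have Ep : 0 <= E by apply: le_trans (HE [ffun=> ord0]); apply: sumr_ge0.
  by apply: (le_trans (y := 0)); rewrite ?oppr_le0 // divr_ge0.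
have low : eps / 2 * N%:R * s2 ^+ d <= \sum_(0 <= a < N) W a * (eps - dev a).
  under eq_bigr do rewrite -TE.
  rewrite sumrB -mulr_sumr -mulr_suml exchange_big /=.
  have h1 : \sum_i \sum_(0 <= a < N) V i a <= d%:R * ((N%:R + E) * (dt * s2 ^+ d.-1)).
    apply: (le_trans (ler_sum _ (fun j _ => sumV j))).
    by rewrite sumr_const card_ord -[leLHS]mulr_natl.
  have h2 : eps * ((N%:R - E) * s2 ^+ d) <= eps * \sum_(0 <= a < N) W a by rewrite ler_pM2l.
  have key : d%:R * dt <= eps * s2 * (5 / 8).
    apply: (le_trans (y := d%:R * (5 * M%:R))); first by rewrite ler_pM2l.
    apply: (le_trans (y := eps * (2 * M%:R ^+ 3) * (5 / 8))).
      by rewrite le_eqVlt /eps; apply/orP; left; apply/eqP; field; rewrite gt_eqF.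
    by apply: ler_wpM2r => //; rewrite ler_pM2l.
  have h3 : d%:R * ((N%:R + E) * (dt * s2 ^+ d.-1)) <= (11 / 10 * N%:R) * (eps * s2 * (5 / 8)) * s2 ^+ d.-1.
    have -> : d%:R * ((N%:R + E) * (dt * s2 ^+ d.-1)) = (N%:R + E) * (d%:R * dt) * s2 ^+ d.-1 by ring.
    apply: ler_wpM2r; first exact: ltW.
    apply: ler_pM => //; [lra| |lra].
    by rewrite mulr_ge0 // sumr_ge0 // => m _; exact: sqr_ge0.
  have h4 : eps * ((9 / 10 * N%:R) * s2 ^+ d) <= eps * ((N%:R - E) * s2 ^+ d).
    rewrite ler_pM2l //; apply: ler_wpM2r; [by rewrite exprn_ge0 // ltW|lra].
  have X0 : 0 <= eps * s2 ^+ d * N%:R.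
    by apply: mulr_ge0 => //; apply: mulr_ge0; rewrite ?exprn_ge0 // ltW.
  move: h3; have -> : 11 / 10 * N%:R * (eps * s2 * (5 / 8)) * s2 ^+ d.-1 = 11 / 16 * (eps * s2 ^+ d * N%:R) by rewrite s2d; field.
  move: h4; have -> : eps * (9 / 10 * N%:R * s2 ^+ d) = 9 / 10 * (eps * s2 ^+ d * N%:R) by ring.
  have -> : eps / 2 * N%:R * s2 ^+ d = 1 / 2 * (eps * s2 ^+ d * N%:R) by ring.
  move: h1 h2 X0; move: (eps * s2 ^+ d * N%:R) => X; clear; lra.
have tp0 k : 0 <= tent_prod k by apply: prodr_ge0 => i _.
have Wle a : W a <= 2 * (s1 ^+ d) ^+ 2.
  have B (g : R -> R) : (forall y, `|g y| <= 1) ->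
      (\sum_k tent_prod k * g (pairing k (x a))) ^+ 2 <= (s1 ^+ d) ^+ 2.
    move=> g1; rewrite -real_normK ?num_real //; apply: lerXn2r; rewrite ?nnegrE ?exprn_ge0 //.
    rewrite -sum_tent_prod; apply: (le_trans (ler_norm_sum _ _ _)); apply: ler_sum => k _.
    by rewrite normrM ger0_norm // ler_piMr.
  have := B cos (@cos_max R); have := B sin (@sin_max R).
  by rewrite /W /trig_sqr; lra.
have up : \sum_(0 <= a < N) W a * (eps - dev a) <=
   2 * (s1 ^+ d) ^+ 2 * eps * \sum_(0 <= a < N) (dev a < eps)%R%:R.
  rewrite mulr_sumr; apply: ler_sum => a _; have W0 : 0 <= W a by exact: trig_sqr_ge0.
  have dev0 : 0 <= dev a by apply: sumr_ge0 => i _; rewrite subr_ge0 cos_le1.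
  case: ltP => h; rewrite ?mulr1 ?mulr0.
    by apply: ler_pM => //; [rewrite subr_ge0 ltW|rewrite gerBl].
  by rewrite mulr_ge0_le0 // subr_le0.
set g := \sum_(0 <= a < N) _ in up *.
have g0 : 0 <= g by apply: sumr_ge0.
have {low up} := le_trans low up.
have -> : eps / 2 * N%:R * s2 ^+ d = eps * (N%:R / 2 * s2 ^+ d) by ring.
have -> : 2 * (s1 ^+ d) ^+ 2 * eps * g = eps * (2 * (s1 ^+ d) ^+ 2 * g) by ring.
rewrite ler_pM2l // => H.
have s2l : (2 * M%:R ^+ 3) ^+ d <= s2 ^+ d.
  by apply: lerXn2r; rewrite ?nnegrE ?mulr_ge0 ?exprn_ge0 // ltW.
have s1u : (s1 ^+ d) ^+ 2 <= (100 * M%:R ^+ 4) ^+ d.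
  rewrite -exprM mulnC exprM; apply: lerXn2r; rewrite ?nnegrE ?mulr_ge0 ?exprn_ge0 //.
  apply: (le_trans (y := (10 * M%:R ^+ 2) ^+ 2)); first by apply: lerXn2r; rewrite ?nnegrE ?mulr_ge0 ?exprn_ge0.
  by rewrite le_eqVlt; apply/orP; left; apply/eqP; ring.
have e : (100 * M%:R ^+ 4) ^+ d = (50 * M%:R) ^+ d * (2 * M%:R ^+ 3) ^+ d :> R.
  by rewrite -exprMn; congr (_ ^+ d); ring.
have P1 : 0 < (50 * M%:R) ^+ d :> R by rewrite exprn_gt0 // mulr_gt0.
have P2 : 0 < (2 * M%:R ^+ 3) ^+ d :> R by rewrite exprn_gt0 // mulr_gt0 // exprn_gt0.
rewrite ler_pdivrMr // -(ler_pM2r P2).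
have H1 : N%:R / 2 * (2 * M%:R ^+ 3) ^+ d <= N%:R / 2 * s2 ^+ d by apply: ler_wpM2l => //; rewrite divr_ge0.
have H2 : 2 * (s1 ^+ d) ^+ 2 * g <= 2 * ((50 * M%:R) ^+ d * (2 * M%:R ^+ 3) ^+ d) * g.
  by rewrite -e; apply: ler_wpM2r => //; rewrite ler_pM2l.
move: H H1 H2; rewrite -/g.
set q1 := (50 * _) ^+ d; set q2 := (2 * _) ^+ d; set q3 := (s1 ^+ d) ^+ 2; set q4 := s2 ^+ d.
have -> : g * q1 * q2 = 2 * (q1 * q2) * g / 2 by field.
clear; lra.
Qed.

End TentKernel.

(** * Curves *)

Section Nondegeneracy.
Variable R : realType.

Lemma derivable_sum_seq (I : Type) (r : seq I) (g : I -> R -> R) (x : R) :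
  (forall i, derivable (g i) x 1) -> derivable (fun t => \sum_(i <- r) g i t) x 1.
Proof.
move=> gx; elim: r => [|i r IH].
  under eq_fun do rewrite big_nil.
  exact: derivable_cst.
under eq_fun do rewrite big_cons.
apply: (derivableD (f := g i) (g := fun t => \sum_(j <- r) g j t)); [exact: gx|exact: IH].
Qed.

Lemma derivable_prod_seq (I : Type) (r : seq I) (g : I -> R -> R) (x : R) :
  (forall i, derivable (g i) x 1) -> derivable (fun t => \prod_(i <- r) g i t) x 1.
Proof.
move=> gx; elim: r => [|i r IH].
  under eq_fun do rewrite big_nil.
  exact: derivable_cst.
under eq_fun do rewrite big_cons.
apply: (derivableM (f := g i) (g := fun t => \prod_(j <- r) g j t)); [exact: gx|exact: IH].
Qed.

Lemma derivable_det m (A : R -> 'M[R]_m) (x : R) :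
  (forall i j, derivable (fun t => A t i j) x 1) -> derivable (fun t => \det (A t)) x 1.
Proof.
move=> Ax; rewrite /determinant.
apply: derivable_sum_seq => s; apply: derivableM; first exact: derivable_cst.
exact: derivable_prod_seq.
Qed.

Lemma derivable_bounded (g : R -> R) (a b : R) : a <= b ->
  (forall y, a <= y <= b -> derivable g y 1) ->
  exists C : nat, forall y, a <= y <= b -> `|g y| <= C%:R.
Proof.
move=> ab dg.
have cg : {within `[a, b], continuous g}.
  by apply: derivable_within_continuous => y; rewrite in_itv /=; exact: dg.
have [c1 _ H1] := EVT_max ab cg; have [c2 _ H2] := EVT_min ab cg.
exists (Num.truncn (`|g c1| + `|g c2|)).+1 => y yab.
have {}yab : y \in `[a, b]%R by rewrite in_itv.
have := H1 y yab; have := H2 y yab => h2 h1.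
have /andP[_ /ltW] := truncn_itv (addr_ge0 (normr_ge0 (g c1)) (normr_ge0 (g c2))).
apply: le_trans; rewrite ler_norml.
have := ler_norm (g c1); have := ler_norm (- g c2); rewrite normrN.
have := normr_ge0 (g c1); have := normr_ge0 (g c2).
by move: h1 h2; clear => *; apply/andP; split; lra.
Qed.

(** The minimum is taken of the differentiable function g^2 in place of |g|. *)
Lemma derivable_nonzero_bounded_away (g : R -> R) (a b : R) : a <= b ->
  (forall y, a <= y <= b -> derivable g y 1) ->
  (forall y, a <= y <= b -> g y != 0) ->
  exists2 c : R, 0 < c & forall y, a <= y <= b -> c <= `|g y|.
Proof.
move=> ab dg g0.
have cg : {within `[a, b], continuous (fun y => g y * g y)}.
  apply: derivable_within_continuous => y; rewrite in_itv /= => yab.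
  by apply: derivableM; exact: dg.
have [c cab H] := EVT_min ab cg; move: cab; rewrite in_itv /= => cab.
exists `|g c|; first by rewrite normr_gt0 g0.
move=> y yab; have := H y; rewrite in_itv /= => /(_ yab).
by rewrite -!expr2 -(real_normK (num_real (g c))) -(real_normK (num_real (g y))) ler_sqr ?nnegrE.
Qed.

Lemma det_le m (A : 'M[R]_m) (b : R) : (forall i j, `|A i j| <= b) ->
  `|\det A| <= (m`!)%:R * b ^+ m.
Proof.
move=> Ab; rewrite /determinant; apply: (le_trans (ler_norm_sum _ _ _)).
apply: (le_trans (y := \sum_(s : {perm 'I_m}) b ^+ m)); last first.
  by rewrite sumr_const -[leLHS]mulr_natl card_Sn.
apply: ler_sum => s _; rewrite normrM normrX normrN1 expr1n mul1r normr_prod.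
rewrite -[m in leRHS]card_ord -prodr_const; apply: ler_prod => i _.
by rewrite normr_ge0 Ab.
Qed.

Lemma derive1n_id k : derive1n k.+1 (fun t : R => t) = fun=> (k == 0%N)%:R.
Proof.
elim: k => [|k IH].
  by apply/funext => x; rewrite derive1n1 derive1E derive_id.
rewrite derive1nS IH; apply/funext => x; rewrite derive1E.
by rewrite (derive_cst ((k == 0%N)%:R : R)).
Qed.

(** Compactness of [-2, 2] makes nondegeneracy quantitative: the determinant is bounded away from 0
    and its minors are bounded, so Cramer's rule recovers [x] from the derivatives of orders 2 to d
    + 1. *)
Lemma nondegenerate_bounds d (f : 'I_d.+1 -> R -> R) (U : set R) : (0 < d)%N ->
  `[(-2)%R, 2%R] `<=` U ->
  (forall i k x, U x -> derivable (derive1n k (f i)) x 1) ->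
  (forall t : R, U t -> \det (wronski f t) != 0) ->
  exists B C0 : nat, [/\ (0 < B)%N, (0 < C0)%N,
    forall (i : 'I_d) k (y : R), -2 <= y <= 2 ->
      is_derive y 1 (derive1n k (f (lift ord0 i))) (derive1n k.+1 (f (lift ord0 i)) y),
    forall (i : 'I_d) k (y : R), (k <= d.+2)%N -> -2 <= y <= 2 ->
      `|derive1n k (f (lift ord0 i)) y| <= B%:R &
    forall (t : R) (x : 'I_d -> R) (s : R), -2 <= t <= 2 ->
      (forall p : 'I_d, `|\sum_i x i * derive1n p.+2 (f (lift ord0 i)) t| <= s) ->
      forall i, `|x i| <= C0%:R * s].
Proof.
move=> d0 sU dU detU.
have inU (y : R) : -2 <= y <= 2 -> U y by move=> y2; apply: sU; rewrite /= in_itv.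
have le2 : -2 <= 2 :> R by lra.
have /choice [b Hb] : forall ik : 'I_d.+1 * 'I_d.+3, exists C : nat,
    forall y : R, -2 <= y <= 2 -> `|derive1n ik.2 (f ik.1) y| <= C%:R.
  by move=> ik; apply: derivable_bounded => // y /inU Uy; exact: dU.
pose B := (\sum_ik b ik).+1.
have Bb i k (y : R) : (k <= d.+2)%N -> -2 <= y <= 2 -> `|derive1n k (f i) y| <= B%:R.
  move=> kd y2; have := Hb (i, inord k) y y2; rewrite /= inordK // => /le_trans; apply.
  by rewrite ler_nat /B (bigD1 (i, inord k)) //= -addnS leq_addr.
have gammaE k (i : 'I_d) t : derive1n k (gamma f (lift ord0 i)) t = derive1n k (f (lift ord0 i)) t.
  by rewrite /gamma.
have W0 t (k : 'I_d.+1) : wronski f t ord0 k = ((k : nat) == 0%N)%:R.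
  by rewrite mxE; exact: (congr1 (fun g => g t) (derive1n_id k)).
have WS t (i : 'I_d) (k : 'I_d.+1) : wronski f t (lift ord0 i) k = derive1n k.+1 (f (lift ord0 i)) t.
  by rewrite mxE gammaE.
have Wb t i k : -2 <= t <= 2 -> `|wronski f t i k| <= B%:R.
  move=> t2; case: (unliftP ord0 i) => [j ->|->].
    by rewrite WS; apply: Bb => //; rewrite ltnS ltnW.
  by rewrite W0 ger0_norm // ler_nat /B; case: eqP.
have Wder i k y : -2 <= y <= 2 -> derivable (fun t => wronski f t i k) y 1.
  move=> /inU Uy; case: (unliftP ord0 i) => [j ->|->].
    have -> : (fun t => wronski f t (lift ord0 j) k) = derive1n k.+1 (f (lift ord0 j)).
      by apply/funext => t; exact: WS.
    exact: dU.
  have -> : (fun t => wronski f t ord0 k) = fun=> ((k : nat) == 0%N)%:R.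
    by apply/funext => t; exact: W0.
  exact: derivable_cst.
have [c c0 Hc] := derivable_nonzero_bounded_away (g := fun t => \det (wronski f t)) le2
   (fun y y2 => derivable_det (fun i j => Wder i j y y2)) (fun y y2 => detU y (inU y y2)).
(* Each entry of the adjugate is a minor of size d, at most d! B^d by [det_le]; there are d + 1
   terms, and [c] bounds the determinant below. *)
pose a : R := d.+1%:R * ((d`!)%:R * B%:R ^+ d) / c.
have a0 : 0 <= a by rewrite /a divr_ge0 ?(ltW c0) // !mulr_ge0 // exprn_ge0.
pose C0 := (Num.truncn a).+1.
have aC : a <= C0%:R by have /andP[_ /ltW] := truncn_itv a0.
exists B, C0; split; [exact: ltn0Sn|exact: ltn0Sn|..].
- move=> i k y /inU Uy; rewrite derive1nS derive1E; apply: derivableP; exact: dU.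
- by move=> i k y; exact: Bb.
move=> t x s t2 xs i.
have s0 : 0 <= s by apply: le_trans (xs (Ordinal d0)).
(* The first row of the matrix is (1, 0, ..., 0), so the added coordinate cancels the first-order
   derivative and leaves the other columns unchanged. *)
pose y : 'rV[R]_d.+1 := \row_j (if unlift ord0 j is Some j' then x j'
   else - \sum_i x i * derive1n 1 (f (lift ord0 i)) t).
have yW k : `|(y *m wronski f t) ord0 k| <= s.
  rewrite mxE big_ord_recl W0 mxE unlift_none.
  have -> : \sum_(j < d) y ord0 (lift ord0 j) * wronski f t (lift ord0 j) k =
      \sum_j x j * derive1n k.+1 (f (lift ord0 j)) t.
    by apply: eq_bigr => j _; rewrite mxE liftK WS.
  case: (unliftP ord0 k) => [p ->|->]; first by rewrite mulr0 add0r; exact: xs.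
  by rewrite /= mulr1 addNr normr0.
have yE : \det (wronski f t) * x i = \sum_k (y *m wronski f t) ord0 k * \adj (wronski f t) k (lift ord0 i).
  have := congr1 (fun M : 'rV_d.+1 => M ord0 (lift ord0 i)) (mulmxA y (wronski f t) (\adj (wronski f t))).
  rewrite mul_mx_adj mul_mx_scalar [in RHS]mxE => <-.
  by rewrite !mxE liftK.
have adjb k : `|\adj (wronski f t) k (lift ord0 i)| <= (d`!)%:R * B%:R ^+ d.
  rewrite mxE /cofactor normrM normrX normrN1 expr1n mul1r.
  by apply: det_le => i' j'; rewrite !mxE; have := Wb t (lift (lift ord0 i) i') (lift k j') t2; rewrite mxE.
have h : c * `|x i| <= d.+1%:R * (s * ((d`!)%:R * B%:R ^+ d)).
  apply: (le_trans (y := `|\det (wronski f t) * x i|)).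
    by rewrite normrM; apply: ler_wpM2r => //; exact: Hc.
  rewrite yE; apply: (le_trans (ler_norm_sum _ _ _)).
  apply: (le_trans (y := \sum_(k < d.+1) s * ((d`!)%:R * B%:R ^+ d))); last first.
    by rewrite sumr_const card_ord -[leLHS]mulr_natl.
  by apply: ler_sum => k _; rewrite normrM; apply: ler_pM.
apply: (le_trans (y := a * s)); last by apply: ler_wpM2r.
rewrite /a mulrAC ler_pdivlMr // mulrC; apply: (le_trans h).
by rewrite le_eqVlt; apply/orP; left; apply/eqP; ring.
Qed.

End Nondegeneracy.

(** * Lattice points near the curve and near-integral values of [lifted_curve] *)

Section NearPoints.
Variables (R : realType) (d : nat) (f : 'I_d.+1 -> R -> R) (B : nat).
Hypothesis f_derive : forall (i : 'I_d) (y : R), -2 <= y <= 2 ->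
  is_derive y 1 (f (lift ord0 i)) (derive1n 1 (f (lift ord0 i)) y).
Hypothesis f_bound : forall (i : 'I_d) (y : R), -2 <= y <= 2 ->
  `|derive1n 1 (f (lift ord0 i)) y| <= B%:R.

Definition near_set (q : nat) (delta : R) : set 'rV[int]_d.+1 :=
  [set b : 'rV[int]_d.+1 |
      eucl_dist ((q%:R)^-1 *: map_mx (fun z : int => z%:~R : R) b) (curveM f)
        < delta / q%:R].

(** The vector x_a of the overview, with a shifted by q so that it runs through 0, ..., 2q. *)
Definition lifted_curve (q a : nat) (i : 'I_d) : R :=
  q%:R * f (lift ord0 i) (a%:R / q%:R - 1).

Lemma coord_le_eucl_norm n (v : 'rV[R]_n) i : `|v ord0 i| <= eucl_norm v.
Proof.
rewrite /eucl_norm -sqrtr_sqr ler_sqrt; last by apply: sumr_ge0 => j _; exact: sqr_ge0.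
by rewrite (bigD1 i) //= lerDl sumr_ge0 // => j _; exact: sqr_ge0.
Qed.

Lemma eucl_norm_le (v : 'rV[R]_d.+1) (s : R) : 0 <= s -> v ord0 ord0 = 0 ->
  (forall i : 'I_d, `|v ord0 (lift ord0 i)| <= s) -> eucl_norm v <= d%:R * s.
Proof.
move=> s0 v0 vs; have ds : 0 <= d%:R * s by rewrite mulr_ge0.
rewrite /eucl_norm -[leRHS]ger0_norm // -sqrtr_sqr ler_sqrt ?sqr_ge0 //.
rewrite big_ord_recl v0 expr0n /= add0r.
apply: (le_trans (y := \sum_(i < d) s ^+ 2)).
  apply: ler_sum => i _; rewrite -real_normK ?num_real //.
  by apply: lerXn2r; rewrite ?nnegrE.
rewrite sumr_const card_ord -[leLHS]mulr_natl exprMn.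
apply: ler_wpM2r; first exact: sqr_ge0.
by rewrite -natrX ler_nat expnS expn1; case: (d) => // m; rewrite leq_pmulr.
Qed.

(** The first coordinate of b/q is within delta/q of the parameter t of a close point of the curve.
    Moving from t to that coordinate changes q f by at most B delta, which is added to the original
    error delta. *)
Lemma near_set_coords q delta (b : 'rV[int]_d.+1) : (0 < q)%N -> delta < 1 / 4 ->
  near_set q delta b ->
  exists2 a : nat, (a < (2 * q).+1)%N /\ b ord0 ord0 = (a : int) - (q : int) &
    forall i, `|(b ord0 (lift ord0 i))%:~R - lifted_curve q a i| <= (B.+1)%:R * delta.
Proof.
move=> q0 d4; have qR : 0 < q%:R :> R by rewrite ltr0n.
rewrite /near_set /= /eucl_dist => /inf_lt [].
  by exists (eucl_norm ((q%:R)^-1 *: map_mx (fun z : int => z%:~R : R) b - gammav f 0)), (gammav f 0) => //; exists 0 => //=; rewrite in_itv /=; apply/andP; split; lra.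
move=> _ [_ [t /= t1 <-] <-] near.
move: t1; rewrite in_itv /= => /andP[t1 t2].
set v := _ - _ in near.
have vi i : `|v ord0 i| < delta / q%:R by apply: le_lt_trans near; exact: coord_le_eucl_norm.
have v0 : `|(b ord0 ord0)%:~R - q%:R * t| < delta.
  have := vi ord0; rewrite /v !mxE /gamma /= -(ltr_pM2l qR) mulrCA mulfV ?gt_eqF // mulr1.
  rewrite -{1}(gtr0_norm qR) -normrM mulrBr mulrA mulfV ?gt_eqF // mul1r.
  exact.
have vs (i : 'I_d) : `|(b ord0 (lift ord0 i))%:~R - q%:R * f (lift ord0 i) t| < delta.
  have := vi (lift ord0 i); rewrite /v !mxE /gamma /= -(ltr_pM2l qR) mulrCA mulfV ?gt_eqF // mulr1.
  rewrite -{1}(gtr0_norm qR) -normrM mulrBr mulrA mulfV ?gt_eqF // mul1r.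
  exact.
(* Integrality and delta < 1 force the first coordinate back into [-q, q] although b/q may lie
   slightly past the end of the curve. *)
have [b1 b2] : (- (q : int) <= b ord0 ord0)%R /\ (b ord0 ord0 <= (q : int))%R.
  move: v0; rewrite ltr_norml => /andP[w1 w2].
  have qt1 : - q%:R <= q%:R * t by nra.
  have qt2 : q%:R * t <= q%:R by nra.
  split; rewrite -ltzD1 -(ltr_int R) intrD mulr1z ?rmorphN /=; lra.
pose a := absz (b ord0 ord0 + (q : int)).
have aE : (a : int) = b ord0 ord0 + (q : int) by rewrite /a gez0_abs //; lia.
exists a; first by split; [move: b2 aE; clear; lia|rewrite aE; ring].
have aR : a%:R = (b ord0 ord0)%:~R + q%:R :> R.
  by have := congr1 (fun z : int => z%:~R : R) aE; rewrite /= intrD.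
have tE : a%:R / q%:R - 1 = (b ord0 ord0)%:~R / q%:R :> R by rewrite aR; field; rewrite gt_eqF.
move=> i; rewrite /lifted_curve tE.
set y := _ / q%:R.
have y1 : -1 <= y by rewrite /y ler_pdivlMr // mulN1r -(ler_int R) ?rmorphN in b1 *.
have y2 : y <= 1 by rewrite /y ler_pdivrMr // mul1r -(ler_int R) in b2 *.
have lip : `|f (lift ord0 i) t - f (lift ord0 i) y| <= B%:R * `|t - y|.
  have H (u w : R) : -1 <= u -> u <= w -> w <= 1 ->
      `|f (lift ord0 i) w - f (lift ord0 i) u| <= B%:R * `|w - u|.
    move=> u1 uw w1.
    have [c /andP[c1 c2] ->] : exists2 c, u <= c <= w &
        f (lift ord0 i) w - f (lift ord0 i) u = derive1n 1 (f (lift ord0 i)) c * (w - u).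
      by apply: mean_value => // z /andP[z1 z2]; apply: f_derive; apply/andP; split; lra.
    by rewrite normrM; apply: ler_wpM2r => //; apply: f_bound; apply/andP; split; lra.
  have [ty|yt] := leP t y; last by apply: H => //; exact: ltW.
  by rewrite distrC (distrC t); exact: H.
have qty : q%:R * `|t - y| <= delta.
  rewrite -{1}(gtr0_norm qR) -normrM mulrBr distrC /y mulrCA mulfV ?gt_eqF // mulr1.
  exact: ltW.
have E : (b ord0 (lift ord0 i))%:~R - q%:R * f (lift ord0 i) y =
  ((b ord0 (lift ord0 i))%:~R - q%:R * f (lift ord0 i) t) + q%:R * (f (lift ord0 i) t - f (lift ord0 i) y) by ring.
rewrite E; apply: (le_trans (ler_normD _ _)); rewrite normrM (gtr0_norm qR).
have h1 : q%:R * `|f (lift ord0 i) t - f (lift ord0 i) y| <= q%:R * (B%:R * `|t - y|) by rewrite ler_pM2l.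
have h2 : B%:R * (q%:R * `|t - y|) <= B%:R * delta by apply: ler_wpM2l.
have h3 := ltW (vs i).
rewrite -natr1; move: h1 h2 h3; clear; lra.
Qed.

(** The parameter a/q - 1 lies in [-1, 1] and matches the first coordinate exactly, so only the d
    others contribute to the distance. *)
Lemma coords_near_set q delta (a : nat) (z : 'I_d -> int) (rho : R) (b : 'rV[int]_d.+1) :
  (0 < q)%N -> (a < (2 * q).+1)%N -> 0 <= rho -> d%:R * rho < delta ->
  (forall i, `|lifted_curve q a i - (z i)%:~R| <= rho) ->
  b ord0 ord0 = (a : int) - (q : int) -> (forall i, b ord0 (lift ord0 i) = z i) ->
  near_set q delta b.
Proof.
move=> q0 aq rho0 dr H b0 bz; have qR : 0 < q%:R :> R by rewrite ltr0n.
set t : R := a%:R / q%:R - 1.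
have aR : a%:R <= 2 * q%:R :> R by rewrite -natrM ler_nat -ltnS.
have tI : t \in `[-1, 1]%R.
  rewrite in_itv /= /t; apply/andP; split; first by rewrite lerBrDr addrC subrr divr_ge0.
  by rewrite lerBlDr ler_pdivrMr //; lra.
set v := (q%:R)^-1 *: map_mx (fun z : int => z%:~R : R) b - gammav f t.
rewrite /near_set /= /eucl_dist; apply: (le_lt_trans (y := eucl_norm v)).
  apply: ge_inf; first by exists 0 => _ [y _ <-]; exact: sqrtr_ge0.
  by exists (gammav f t) => //; exists t.
apply: (le_lt_trans (y := d%:R * (rho / q%:R))); last first.
  by rewrite mulrA ltr_pM2r ?invr_gt0.
apply: eucl_norm_le; first by rewrite divr_ge0 // ltW.
  rewrite /v !mxE /gamma /= b0 /t intrD rmorphN /= mulrBr mulVf ?gt_eqF //.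
  by rewrite mulrC subrr.
move=> i; rewrite /v !mxE /gamma /= bz.
rewrite ler_pdivlMr // -{2}(gtr0_norm qR) -normrM mulrBl mulrC mulrA mulfV ?gt_eqF // mul1r.
by rewrite distrC mulrC; exact: H.
Qed.

Let M := (B.+1 + B.+1).+2.

(** Given a, each further coordinate lies within B + 1 of the corresponding value of [lifted_curve],
    which leaves fewer than [M] integers. Finiteness is part of the conclusion because [fset_set] is
    a default value on infinite sets. *)
Lemma near_set_count (q : nat) (delta : R) (good : nat -> bool) :
  (0 < q)%N -> 0 < delta < 1 / 4 ->
  (forall a, (a < (2 * q).+1)%N ->
     (exists z : 'I_d -> int, forall i, `|lifted_curve q a i - (z i)%:~R| <= B.+1%:R * delta) ->
     good a) ->
  finite_set (near_set q delta) /\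
  (NM f q delta <= M ^ d * \sum_(0 <= a < (2 * q).+1) good a)%N.
Proof.
move=> q0 /andP[d0 d4] Hg.
pose P : pred ('I_(2 * q).+1 * {ffun 'I_d -> 'I_M}) := fun p => good p.1.
pose G (p : 'I_(2 * q).+1 * {ffun 'I_d -> 'I_M}) : 'rV[int]_d.+1 :=
  \row_j (if unlift ord0 j is Some i then
    Num.floor (lifted_curve q p.1 i) - (B.+1 : int) + ((p.2 i : nat) : int)
    else ((p.1 : nat) : int) - (q : int)).
pose s := [seq G p | p <- enum P].
have sub : near_set q delta `<=` [set` [fset x in s]%fset].
  move=> b /(near_set_coords q0 d4) [a [aq b0] Hb].
  have ri (i : 'I_d) : exists r : 'I_M, b ord0 (lift ord0 i) =
      Num.floor (lifted_curve q a i) - (B.+1 : int) + ((r : nat) : int).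
    have /andP[f1 f2] := floor_itv (lifted_curve q a i).
    have := Hb i; rewrite ler_norml => /andP[h1 h2].
    have Bd : B.+1%:R * delta <= B.+1%:R by rewrite ler_piMr //; lra.
    set F := Num.floor _ in f1 f2 *; set c := b _ _ in h1 h2 *.
    have c1 : (F - (B.+1 : int) <= c)%R.
      rewrite -(ler_int R) intrD rmorphN /=; lra.
    have c2 : (c < F + (B.+1 : int) + 1)%R.
      rewrite -(ltr_int R) !intrD mulr1z /= ; move: f2; rewrite intrD mulr1z; lra.
    have rM : (absz (c - (F - (B.+1 : int))%R)%R < M)%N by move: c1 c2; rewrite /M; clear; lia.
    exists (Ordinal rM) => /=; move: c1; clear; lia.
  have /choice [r Hr] := ri.
  rewrite /= !inE; apply/mapP; exists (Ordinal aq, [ffun i => r i]).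
    rewrite mem_enum; change (is_true (good a)); apply: Hg => //.
    exists (fun i => b ord0 (lift ord0 i)) => i; rewrite distrC; exact: Hb.
  apply/rowP => j; rewrite mxE; case: (unliftP ord0 j) => [i ->|->].
    by rewrite ffunE Hr.
  by rewrite b0.
have fin := finite_subfset _ sub; split => //.
apply: (leq_trans (n := #|` [fset x in s]%fset|)).
  rewrite /NM; apply: fsubset_leq_card; apply/fsubsetP => b.
  by rewrite in_fset_set // => /set_mem nb; exact: (sub b nb).
rewrite card_fseq; apply: (leq_trans (size_undup _)); rewrite size_map -cardE.
have -> : #|P| = (\sum_(a < (2 * q).+1) \sum_(r : {ffun 'I_d -> 'I_M}) good a)%N.
  rewrite pair_bigA /= -sum1_card big_mkcond /=; apply: eq_bigr => p _.
  by rewrite -[p \in P]/(good p.1); case: (good p.1).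
rewrite big_mkord big_distrr /=; apply: leq_sum => a _.
by rewrite sum_nat_const card_ffun !card_ord.
Qed.

(** Different a give lattice points with different first coordinates. Finiteness comes from
    [near_set_count] with the predicate that is always true. *)
Lemma near_set_ge (q : nat) (delta rho : R) (good : nat -> bool) :
  (0 < q)%N -> 0 < delta < 1 / 4 -> 0 <= rho -> d%:R * rho < delta ->
  (forall a, (a < (2 * q).+1)%N -> good a ->
     exists z : 'I_d -> int, forall i, `|lifted_curve q a i - (z i)%:~R| <= rho) ->
  (\sum_(0 <= a < (2 * q).+1) good a <= NM f q delta)%N.
Proof.
move=> q0 d4 rho0 dr Hg.
have [fin _] := @near_set_count q delta xpredT q0 d4 (fun _ _ _ => isT).
have /choice [z Hz] : forall a : nat, exists z : 'I_d -> int, (a < (2 * q).+1)%N -> good a ->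
    forall i, `|lifted_curve q a i - (z i)%:~R| <= rho.
  move=> a; have [|] := boolP ((a < (2 * q).+1)%N && good a).
    by move=> /andP[aq /(Hg a aq) [z Hz]]; exists z.
  by move=> nag; exists (fun=> 0) => aq ga; move: nag; rewrite aq ga.
pose G (a : nat) : 'rV[int]_d.+1 :=
  \row_j (if unlift ord0 j is Some i then z a i else (a : int) - (q : int)).
have Ginj : injective G.
  move=> a a' /rowP /(_ ord0); rewrite !mxE unlift_none => /addIr.
  by case.
pose s := [seq G a | a <- index_iota 0 (2 * q).+1 & good a].
have us : uniq s by rewrite map_inj_uniq // filter_uniq // iota_uniq.
have -> : (\sum_(0 <= a < (2 * q).+1) good a = size s)%N.
  by rewrite size_map size_filter -sum1_count [RHS]big_mkcond /=; apply: eq_bigr => a _; case: (good a).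
rewrite -(undup_id us) -card_fseq /NM; apply: fsubset_leq_card; apply/fsubsetP => b.
rewrite !inE => /mapP [a]; rewrite mem_filter mem_index_iota => /andP[ga /andP[_ aq]] ->.
rewrite in_fset_set //; apply/mem_set.
apply: (coords_near_set (z := z a) q0 aq rho0 dr); first exact: Hz.
  by rewrite mxE unlift_none.
by move=> i; rewrite mxE liftK.
Qed.

End NearPoints.

(** * The exponents of the theorem in terms of one integer *)

Section Exponents.
Variable R : realType.

(** One less than the largest product of two natural numbers with sum n + 2; it is the exponent D in
    the condition that L^D be a small multiple of q. *)
Definition critical_degree (n : nat) : nat := (n.+2 ^ 2 %/ 4).-1.

Lemma critical_degreeE n : (3 <= n)%N ->
  4 * (critical_degree n).+1%:R = (n * (n + 4))%:R + 4 - (odd n)%:R :> R.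
Proof.
move=> n3; rewrite /critical_degree.
have : (4 * (n.+2 ^ 2 %/ 4) + odd n = n * (n + 4) + 4)%N.
  rewrite -[in RHS](odd_double_half n) -[in n.+2](odd_double_half n) -muln2.
  move: (odd n) (n./2) => b m.
  have -> : ((b + m * 2).+2 ^ 2 = (m * m + m * 2 + 1 + b * (m + 1)) * 4 + b)%N.
    by case: b; rewrite expnS expn1; nia.
  rewrite divnMDl // divn_small ?addn0; last by case: b.
  by case: b; nia.
move=> E; have p0 : (0 < n.+2 ^ 2 %/ 4)%N by rewrite divn_gt0 // expnS expn1; nia.
rewrite prednK // -natrM.
have -> : (4 * (n.+2 ^ 2 %/ 4))%:R = (4 * (n.+2 ^ 2 %/ 4) + odd n)%:R - (odd n)%:R :> R.
  by rewrite natrD addrK.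
by rewrite E natrD.
Qed.

Lemma critical_degree_gt0 n : (3 <= n)%N -> (0 < critical_degree n)%N.
Proof.
move=> n3; rewrite /critical_degree -ltnS prednK; last by rewrite divn_gt0 // expnS expn1; nia.
by rewrite leq_divRL // expnS expn1; nia.
Qed.

(** The two factors have sum d + 3, so this is the inequality of arithmetic and geometric means. *)
Lemma mul_le_critical_degree d p : (p < d)%N ->
  (p.+2 * (d - p).+1 <= (critical_degree d.+1).+1)%N.
Proof.
move=> pd; rewrite /critical_degree prednK; last by rewrite divn_gt0 // expnS expn1; nia.
rewrite leq_divRL // mulnC; have [h _] := nat_AGM2 p.+2 (d - p).+1.
have e : (p.+2 + (d - p).+1 = d.+3)%N by move: pd; clear; lia.
by rewrite e in h.
Qed.

Lemma lower_expE n : (3 <= n)%N -> lower_exp R n = (critical_degree n)%:R^-1.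
Proof.
move=> n3; have E := critical_degreeE n3; rewrite -natr1 in E.
have D0 : (critical_degree n)%:R != 0 :> R by rewrite pnatr_eq0 -lt0n critical_degree_gt0.
have -> : (critical_degree n)%:R = ((n * (n + 4))%:R - (odd n)%:R) / 4 :> R by lra.
rewrite /lower_exp invf_div; case: (odd n) => //=.
by rewrite subr0.
Qed.

Lemma ThetaE n : (3 <= n)%N -> Theta R n = 1 - (n - 1)%:R * lower_exp R n.
Proof.
move=> n3; have E := critical_degreeE n3; rewrite -natr1 in E.
have D0 : 0 < (critical_degree n)%:R :> R by rewrite ltr0n critical_degree_gt0.
rewrite /Theta /lower_exp natrB; last by apply: leq_trans n3.
rewrite !natrD !natrX !natrM !natrD in E *.
case: (odd n) E => /= E.
  have h : n%:R * (n%:R + 4) - 1 != 0 :> R by rewrite gt_eqF //; lra.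
  by field.
have n0 : 0 < n%:R :> R by rewrite ltr0n (leq_trans _ n3).
have h1 : n%:R != 0 :> R by rewrite gt_eqF.
have h2 : n%:R + 4 != 0 :> R by rewrite gt_eqF // addr_gt0.
by field; rewrite h1 h2.
Qed.

End Exponents.

(** * The two counting bounds *)

Section NearPointCounts.
Variables (R : realType) (d : nat) (f : 'I_d.+1 -> R -> R) (B D : nat) (eps : R).
Hypothesis d_gt0 : (0 < d)%N.
Hypothesis D_gt0 : (0 < D)%N.
Hypothesis eps_bounds : 0 < eps <= 1.
Hypothesis f_derive : forall (i : 'I_d) (y : R), -2 <= y <= 2 ->
  is_derive y 1 (f (lift ord0 i)) (derive1n 1 (f (lift ord0 i)) y).
Hypothesis f_bound : forall (i : 'I_d) (y : R), -2 <= y <= 2 ->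
  `|derive1n 1 (f (lift ord0 i)) y| <= B%:R.
Hypothesis off_diagonal : forall q L (k : {ffun 'I_d -> 'I_L}), (0 < q)%N -> (0 < L)%N ->
  L%:R ^+ D <= eps * q%:R ->
  \sum_(l | l != k) `|\sum_(0 <= a < (2 * q).+1)
     cos (pairing k (lifted_curve f q a) - pairing l (lifted_curve f q a))| <= 1 / 5 * q%:R.

Let M := (B.+1 + B.+1).+2.

(** The squared Dirichlet kernel has sum at most 4 q L^d over a, and is at least L^(2d) / 4 at each
    a that is counted. *)
Lemma near_integer_count (q L : nat) (rho : R) : (0 < q)%N -> (0 < L)%N ->
  L%:R ^+ D <= eps * q%:R -> 2 * pi * d%:R * L%:R * rho <= 1 ->
  (\sum_(0 <= a < (2 * q).+1)
    `[< exists z : 'I_d -> int, forall i, (`|lifted_curve f q a i - (z i)%:~R| <= rho)%R >])%:R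
  <= 16 * q%:R / L%:R ^+ d :> R.
Proof.
move=> q0 L0 LD Lrho.
have LR : 0 < L%:R :> R by rewrite ltr0n.
have qR : 1 <= q%:R :> R by rewrite ler1n.
have := sum_trig_sqr (fun=> 1) (th := fun a k => pairing k (lifted_curve f q a))
  (fun k => off_diagonal k q0 L0 LD).
have -> : \sum_(k : {ffun 'I_d -> 'I_L}) (1 : R) ^+ 2 = L%:R ^+ d.
  rewrite (eq_bigr (fun=> 1)); last by move=> k _; rewrite expr1n.
  by rewrite sumr_const card_ffun !card_ord natrX.
set T := \sum_(0 <= a < _) trig_sqr _ _.
rewrite ler_norml => /andP[_ h].
have p0 : 0 < L%:R ^+ d :> R by rewrite exprn_gt0.
have h2 : T <= 4 * q%:R * L%:R ^+ d.
  have : (2 * q).+1%:R * L%:R ^+ d + 1 / 5 * q%:R * L%:R ^+ d <= 4 * q%:R * L%:R ^+ d :> R.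
    by rewrite -mulrDl ler_pM2r // -natr1 natrM; lra.
  by move: h; rewrite lerBlDr addrC => h; apply: le_trans.
have h3 : (\sum_(0 <= a < (2 * q).+1)
    `[< exists z : 'I_d -> int, forall i, (`|lifted_curve f q a i - (z i)%:~R| <= rho)%R >])%:R
    * (L%:R ^+ d / 2) ^+ 2 <= T.
  rewrite natr_sum mulr_suml; apply: ler_sum => a _.
  case: asboolP => [[z Hz]|_]; last by rewrite mul0r trig_sqr_ge0.
  rewrite mul1r; apply: (dirichlet_ge (z := z)) => i; apply: le_trans Lrho.
  by apply: ler_wpM2l => //; rewrite !mulr_ge0 // pi_ge0.
rewrite ler_pdivlMr // -(ler_pM2r p0).
move: h2 h3; rewrite expr2; set X := (\sum_(_ <= _ < _) _)%:R; set Y := L%:R ^+ d.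
have -> : X * (Y / 2 * (Y / 2)) = X * Y * Y / 4 by field.
lra.
Qed.

Lemma near_set_trivial (q : nat) (delta : R) : (0 < q)%N -> 0 < delta < 1 / 4 ->
  (NM f q delta)%:R <= (M ^ d)%:R * (3 * q%:R) :> R.
Proof.
move=> q0 d4.
have [_] := @near_set_count R d f B f_derive f_bound q delta xpredT q0 d4 (fun _ _ _ => isT).
rewrite sum_nat_const_nat muln1 subn0 -(ler_nat R) natrM => /le_trans; apply.
by apply: ler_wpM2l => //; rewrite -natrM ler_nat; move: q0; clear; lia.
Qed.

Lemma near_set_upper (q L : nat) (delta : R) : (0 < q)%N -> (0 < L)%N ->
  0 < delta < 1 / 4 -> L%:R ^+ D <= eps * q%:R ->
  2 * pi * d%:R * L%:R * (B.+1%:R * delta) <= 1 ->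
  (NM f q delta)%:R <= (M ^ d)%:R * (16 * q%:R / L%:R ^+ d) :> R.
Proof.
move=> q0 L0 d4 LD Ld.
have [_] := @near_set_count R d f B f_derive f_bound q delta
  (fun a => `[< exists z : 'I_d -> int, forall i, `|lifted_curve f q a i - (z i)%:~R| <= B.+1%:R * delta >])
  q0 d4 (fun a _ H => introT (asboolP _) H).
rewrite -(ler_nat R) natrM => /le_trans; apply.
by apply: ler_wpM2l => //; exact: near_integer_count.
Qed.

(** [tent_count] provides a with total deviation below 4d / M0^2; then every coordinate is within 2d
    / M0 of an integer, and d times this is still below delta. *)
Lemma near_set_lower (q M0 : nat) (delta : R) : (0 < q)%N -> (0 < M0)%N ->
  0 < delta < 1 / 4 -> (4 * M0).+1%:R ^+ D <= eps * q%:R ->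
  2 * d%:R ^+ 2 / M0%:R < delta ->
  q%:R / 2 / (50 * M0%:R) ^+ d <= (NM f q delta)%:R :> R.
Proof.
move=> q0 M00 d4 LD Md.
have M0R : 0 < M0%:R :> R by rewrite ltr0n.
have dR : 1 <= d%:R :> R by rewrite ler1n.
have E10 : 1 / 5 * q%:R <= (2 * q).+1%:R / 10 :> R by rewrite -(natr1 (2 * q)) natrM; lra.
have := tent_count M00 d_gt0 E10 (fun k => off_diagonal k q0 (ltn0Sn _) LD).
set good : nat -> bool := fun a => \sum_i (1 - cos (2 * pi * lifted_curve f q a i)) < 4 * d%:R / M0%:R ^+ 2.
have rho0 : 0 <= 2 * d%:R / M0%:R :> R by rewrite divr_ge0 ?mulr_ge0 // ltW.
have dr : d%:R * (2 * d%:R / M0%:R) < delta.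
  by move: Md; have -> : 2 * d%:R ^+ 2 / M0%:R = d%:R * (2 * d%:R / M0%:R) :> R by ring.
have := @near_set_ge R d f B f_derive f_bound q delta _ good q0 d4 rho0 dr.
have goodP : forall a, (a < (2 * q).+1)%N -> good a ->
    exists z : 'I_d -> int, forall i, `|lifted_curve f q a i - (z i)%:~R| <= 2 * d%:R / M0%:R.
  move=> a _ ga; exists (fun i => Num.floor (lifted_curve f q a i + 1 / 2)) => i.
  set x := lifted_curve f q a i; set z := Num.floor _.
  have /andP[z1 z2] := floor_itv (x + 1 / 2); rewrite -/z intrD mulr1z in z1 z2.
  have h1 : `|x - z%:~R| <= 1 / 2 by rewrite ler_norml; apply/andP; split; lra.
  have h2 := one_sub_cos_2pi_ge h1.
  have cE : cos (2 * pi * (x - z%:~R)) = cos (2 * pi * x).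
    by rewrite -[RHS](cosD2piz _ (- z)); congr cos; rewrite rmorphN /=; ring.
  rewrite cE in h2.
  have h3 : 1 - cos (2 * pi * x) <= \sum_i (1 - cos (2 * pi * lifted_curve f q a i)).
    by rewrite (bigD1 i) //= lerDl sumr_ge0 // => j _; rewrite subr_ge0 cos_le1.
  have h4 : (x - z%:~R) ^+ 2 <= (2 * d%:R / M0%:R) ^+ 2.
    apply: (le_trans (y := 2 * d%:R / M0%:R ^+ 2)).
      have := ltW ga; have -> : 4 * d%:R / M0%:R ^+ 2 = 2 * (2 * d%:R / M0%:R ^+ 2) :> R by ring.
      lra.
    rewrite exprMn exprVn ler_pM2r ?invr_gt0 ?exprn_gt0 //.
    nra.
  by rewrite -[leRHS]ger0_norm // -ler_sqr ?nnegrE // !real_normK ?num_real.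
move=> /(_ goodP); rewrite -(ler_nat R) natr_sum => H1 H2.
apply: le_trans H1; apply: le_trans H2.
apply: ler_wpM2r; first by rewrite invr_ge0 exprn_ge0 // mulr_ge0.
by rewrite -(natr1 (2 * q)) natrM; lra.
Qed.

(** The best L is the smaller of (eps q)^(1/D), which [off_diagonal] allows, and a multiple of
    1/delta, which [dirichlet_ge] allows. The first gives the power of q, the second delta^d q. *)
Lemma near_set_upper_bound (nu : R) : 0 < nu -> (d <= D)%N ->
  exists C : R, 0 < C /\
    forall (q : nat) (delta : R), (0 < q)%N -> 0 < delta < 1 / 4 ->
      (NM f q delta)%:R <=
      C * (delta ^+ d * q%:R + q%:R `^ (1 - d%:R * D%:R^-1 + nu)).
Proof.
move=> hnu dD.
set lam : R := D%:R^-1.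
have DR : 1 <= D%:R :> R by rewrite ler1n.
have lamD : lam * D%:R = 1 by rewrite mulVf // pnatr_eq0 -lt0n.
have dR : 1 <= d%:R :> R by rewrite ler1n.
have /andP[ep e1] := eps_bounds.
have lam0 : 0 < lam by rewrite invr_gt0 ltr0n.
have lam1 : lam <= 1 by rewrite invf_le1 // ltr0n.
have rootD (y : R) : 0 <= y -> (y `^ lam) ^+ D = y.
  by move=> y0; rewrite -powR_mulrn ?powR_ge0 // -powRrM lamD powRr1.
pose w0 : R := 1 / (2 * pi * d%:R * B.+1%:R).
have wd0 : 0 < 2 * pi * d%:R * B.+1%:R :> R.
  by rewrite !mulr_gt0 ?ltr0n // pi_gt0.
have w0p : 0 < w0 by rewrite divr_gt0.
pose m0 : R := (((B.+1 + B.+1).+2) ^ d)%:R.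
have m0p : 0 < m0 by rewrite ltr0n expn_gt0.
(* One constant for each case: q bounded, delta bounded below, L limited by q, L limited by delta.
   The first two use the trivial bound. *)
pose K1 : R := 3 / eps; pose K2 : R := 3 / w0 ^+ d.
pose K3 : R := 16 * (2 / eps) ^+ d; pose K4 : R := 16 * (2 / w0) ^+ d.
have K1p : 0 < K1 by rewrite divr_gt0.
have K2p : 0 < K2 by rewrite divr_gt0 // exprn_gt0.
have K3p : 0 < K3 by rewrite mulr_gt0 // exprn_gt0 // divr_gt0.
have K4p : 0 < K4 by rewrite mulr_gt0 // exprn_gt0 // divr_gt0.
exists (m0 * (K1 + K2 + K3 + K4)); split; first by rewrite mulr_gt0 // !addr_gt0.
move=> q delta q0 d4; have /andP[dp dlt] := d4.
have q1 : 1 <= q%:R :> R by rewrite ler1n.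
have qp : 0 < q%:R :> R by rewrite ltr0n.
set X := delta ^+ d * q%:R; set Y := q%:R `^ _.
have X0 : 0 <= X by rewrite mulr_ge0 // exprn_ge0 // ltW.
have YT : q%:R / (q%:R `^ lam) ^+ d <= Y.
  have -> : q%:R / (q%:R `^ lam) ^+ d = q%:R `^ (1 - d%:R * lam).
    rewrite powRD; last by rewrite (gt_eqF qp) /= implybT.
    by rewrite powRr1 // powRN (mulrC d%:R) powRrM powR_mulrn // powR_ge0.
  by apply: ler_powR => //; rewrite lerDl ltW.
have Y1 : 1 <= Y.
  rewrite -[leLHS](powRr0 q%:R); apply: ler_powR => //.
  rewrite addr_ge0 ?(ltW hnu) // subr_ge0.
  by rewrite ler_pdivrMr ?mul1r ?ltr0n // ler_nat.
have fin K Z : 0 <= K -> K <= K1 + K2 + K3 + K4 -> 0 <= Z -> Z <= X + Y ->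
    (NM f q delta)%:R <= m0 * (K * Z) -> (NM f q delta)%:R <= m0 * (K1 + K2 + K3 + K4) * (X + Y).
  move=> K0 KK Z0 ZXY /le_trans; apply.
  by rewrite -mulrA; apply: ler_wpM2l; [exact: ltW|exact: ler_pM].
have triv := near_set_trivial q0 d4; rewrite -/m0 in triv.
have [small|big] := ltP (eps * q%:R) 1.
  apply: (fin K1 1); [exact: ltW|lra|by []|lra|].
  apply: (le_trans triv); rewrite ler_pM2l // mulr1 /K1 ler_pdivlMr //.
  by rewrite -mulrA [q%:R * eps]mulrC; lra.
have [dl|dw] := leP w0 delta.
  apply: (fin K2 X); [exact: ltW|lra|by []|lra|].
  apply: (le_trans triv); rewrite ler_pM2l // /K2 /X.
  have -> : 3 / w0 ^+ d * (delta ^+ d * q%:R) = delta ^+ d / w0 ^+ d * (3 * q%:R) by ring.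
  rewrite ler_peMl ?mulr_ge0 // ler_pdivlMr ?exprn_gt0 // mul1r.
  by apply: lerXn2r; rewrite ?nnegrE // ltW.
pose y := (eps * q%:R) `^ lam.
have yge : eps * q%:R `^ lam <= y.
  rewrite /y powRM ?(ltW ep) //; apply: ler_wpM2r; first exact: powR_ge0.
  exact: ger1_powR.
have y1 : 1 <= y.
  by rewrite /y -[leLHS](powRr0 (eps * q%:R)); apply: ler_powR => //; exact: ltW.
have yD : y ^+ D = eps * q%:R by rewrite /y rootD // mulr_ge0 // ltW.
pose m := Num.min y (w0 / delta).
have m1 : 1 <= m by rewrite /m le_min y1 ler_pdivlMr // mul1r ltW.
have my : m <= y by rewrite /m ge_min lexx.
have mw : m <= w0 / delta by rewrite /m ge_min lexx orbT.
pose L := Num.truncn m.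
have /andP[Lm mL] : L%:R <= m < L.+1%:R by apply: truncn_itv; lra.
have L0 : (0 < L)%N by rewrite -ltnS -(ltr_nat R); apply: le_lt_trans mL.
have L1 : 1 <= L%:R :> R by rewrite ler1n.
have mL2 : m / 2 <= L%:R by move: mL; rewrite -natr1; lra.
have LD : L%:R ^+ D <= eps * q%:R.
  rewrite -yD; apply: lerXn2r; rewrite ?nnegrE //; last exact: le_trans my.
  by apply: le_trans y1.
have Ld : 2 * pi * d%:R * L%:R * (B.+1%:R * delta) <= 1.
  have -> : 2 * pi * d%:R * L%:R * (B.+1%:R * delta) = L%:R * delta * (2 * pi * d%:R * B.+1%:R) by ring.
  rewrite -ler_pdivlMr // -/w0 -ler_pdivlMr //; exact: le_trans mw.
have := near_set_upper q0 L0 d4 LD Ld; rewrite -/m0 => up.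
have mp : 0 < m by apply: lt_le_trans m1.
have up2 : (NM f q delta)%:R <= m0 * (16 * q%:R * (2 / m) ^+ d).
  apply: (le_trans up); rewrite ler_pM2l // ler_pM2l ?mulr_gt0 //.
  rewrite -exprVn; apply: lerXn2r; rewrite ?nnegrE ?invr_ge0 ?divr_ge0 // ?(ltW mp) //.
  have -> : 2 / m = (m / 2)^-1 by rewrite invf_div.
  by rewrite lef_pV2 // posrE ?divr_gt0 // ltr0n.
have [yw|wy] := leP y (w0 / delta).
  have mE : m = y by rewrite /m; apply/min_idPl.
  apply: (fin K3 Y); [exact: ltW|lra|lra|lra|].
  apply: (le_trans up2); rewrite ler_pM2l // mE /K3 -!mulrA ler_pM2l //.
  have qlp : 0 < q%:R `^ lam by rewrite powR_gt0.
  have yp : 0 < y by apply: lt_le_trans y1.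
  apply: (le_trans (y := q%:R * (2 / (eps * q%:R `^ lam)) ^+ d)).
    rewrite ler_pM2l //; apply: lerXn2r; rewrite ?nnegrE ?divr_ge0 ?mulr_ge0 ?powR_ge0 // ?(ltW yp) ?(ltW ep) //.
    by rewrite ler_pM2l // lef_pV2 // posrE ?mulr_gt0.
  have -> : q%:R * (2 / (eps * q%:R `^ lam)) ^+ d = (2 / eps) ^+ d * (q%:R / (q%:R `^ lam) ^+ d).
    rewrite (_ : 2 / (eps * _) = 2 / eps * (q%:R `^ lam)^-1); last by rewrite invfM mulrA.
    by rewrite [in LHS]exprMn [in LHS]exprVn mulrCA.
  by apply: ler_wpM2l => //; rewrite exprn_ge0 // divr_ge0 // ltW.
have mE : m = w0 / delta by rewrite /m; apply/min_idPr; exact: ltW.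
apply: (fin K4 X); [exact: ltW|lra|by []|lra|].
apply: (le_trans up2); rewrite ler_pM2l // mE /K4 /X invf_div.
have -> : 2 * (delta / w0) = 2 / w0 * delta by ring.
by rewrite exprMn le_eqVlt; apply/orP; left; apply/eqP; ring.
Qed.

(** The kernel has degree 4 M0 + 1 with M0 about 2 d^2 / delta. The assumption on delta gives
    delta^(-D) <= q^(1 - nu D), and the factor q^(nu D) absorbs all constants once q is large. *)
Lemma near_set_lower_bound (nu : R) : 0 < nu ->
  exists (q0 : nat) (c : R), 0 < c /\
    forall (q : nat) (delta : R), (0 < q)%N -> (q0 <= q)%N -> 0 < delta < 1 / 4 ->
      q%:R `^ (- D%:R^-1 + nu) <= delta ->
      c * (delta ^+ d * q%:R) <= (NM f q delta)%:R.
Proof.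
move=> hnu.
set lam : R := D%:R^-1.
have DR : 1 <= D%:R :> R by rewrite ler1n.
have lamD : lam * D%:R = 1 by rewrite mulVf // pnatr_eq0 -lt0n.
have dR : 1 <= d%:R :> R by rewrite ler1n.
have /andP[ep e1] := eps_bounds.
(* 15 d^2 / delta bounds the degree: M0 <= 3 d^2 / delta and 4 M0 + 1 <= 5 M0. *)
pose Z : R := (15 * d%:R ^+ 2) ^+ D / eps.
have Zp : 0 < Z.
  by rewrite divr_gt0 // exprn_gt0 // mulr_gt0 // exprn_gt0 // ltr0n.
have nD : 0 < nu * D%:R by rewrite mulr_gt0 // ltr0n.
exists (Num.truncn (Z `^ (nu * D%:R)^-1)).+1, (1 / (2 * (150 * d%:R ^+ 2) ^+ d)).
have P150 : 0 < (150 * d%:R ^+ 2) ^+ d :> R.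
  by rewrite exprn_gt0 // mulr_gt0 // exprn_gt0 // ltr0n.
split; first by rewrite divr_gt0 // mulr_gt0.
move=> q delta q0 qq0 d4 dge; have /andP[dp dlt] := d4.
have qp : 0 < q%:R :> R by rewrite ltr0n.
have d2 : 1 <= d%:R ^+ 2 :> R by rewrite exprn_ege1.
have qZ : Z <= q%:R `^ (nu * D%:R).
  have /andP[_ h] : (Num.truncn (Z `^ (nu * D%:R)^-1))%:R <= Z `^ (nu * D%:R)^-1 < (Num.truncn (Z `^ (nu * D%:R)^-1)).+1%:R.
    by apply: truncn_itv; exact: powR_ge0.
  have h2 : Z `^ (nu * D%:R)^-1 <= q%:R by apply: (le_trans (ltW h)); rewrite ler_nat.
  have -> : Z = (Z `^ (nu * D%:R)^-1) `^ (nu * D%:R).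
    by rewrite -powRrM mulVf ?gt_eqF // powRr1 // ltW.
  by apply: ge0_ler_powR; rewrite ?nnegrE ?powR_ge0 //; exact: ltW.
pose t := 2 * d%:R ^+ 2 / delta.
have t0 : 0 <= t by rewrite divr_ge0 ?(ltW dp) // mulr_ge0 // sqr_ge0.
pose M0 := (Num.truncn t).+1.
have /andP[tl tu] := truncn_itv t0.
have M0p : 0 < M0%:R :> R by rewrite ltr0n.
have Md : 2 * d%:R ^+ 2 / M0%:R < delta.
  have h : 2 * d%:R ^+ 2 < M0%:R * delta by move: tu; rewrite /t ltr_pdivrMr.
  by rewrite ltr_pdivrMr // (mulrC delta).
have one : 1 <= d%:R ^+ 2 / delta by rewrite ler_pdivlMr // mul1r; lra.
have M0u : M0%:R <= 3 * (d%:R ^+ 2 / delta).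
  rewrite /M0 -natr1.
  have -> : 3 * (d%:R ^+ 2 / delta) = t + d%:R ^+ 2 / delta by rewrite /t; ring.
  by apply: lerD.
have LD : (4 * M0).+1%:R ^+ D <= eps * q%:R.
  have h1 : (4 * M0).+1%:R <= 15 * d%:R ^+ 2 / delta :> R.
    have : 1 <= M0%:R :> R by rewrite ler1n.
    have -> : 15 * d%:R ^+ 2 / delta = 5 * (3 * (d%:R ^+ 2 / delta)) by ring.
    by rewrite -natr1 natrM; lra.
  have h150 : 0 <= 15 * d%:R ^+ 2 / delta by apply: le_trans h1.
  apply: (le_trans (y := (15 * d%:R ^+ 2 / delta) ^+ D)); first by apply: lerXn2r; rewrite ?nnegrE.
  have dD : 0 < delta ^+ D by rewrite exprn_gt0.
  rewrite exprMn exprVn ler_pdivrMr //.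
  have h2 : q%:R `^ (- 1 + nu * D%:R) <= delta ^+ D.
    have -> : q%:R `^ (- 1 + nu * D%:R) = (q%:R `^ (- lam + nu)) ^+ D :> R.
      by rewrite -powR_mulrn ?powR_ge0 // -powRrM mulrDl mulNr lamD.
    by apply: lerXn2r; rewrite ?nnegrE ?powR_ge0 // ltW.
  apply: (le_trans (y := eps * q%:R * q%:R `^ (- 1 + nu * D%:R))); last first.
    by rewrite ler_pM2l // mulr_gt0.
  rewrite powRD; last by rewrite (gt_eqF qp) /= implybT.
  rewrite powR_inv1 // mulrA mulfK ?gt_eqF //.
  by move: qZ; rewrite /Z ler_pdivrMr // (mulrC eps).
have := near_set_lower q0 (ltn0Sn _) d4 LD Md.
apply: le_trans.
have h : (50 * M0%:R) ^+ d <= (150 * d%:R ^+ 2) ^+ d / delta ^+ d.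
  rewrite -exprVn -exprMn; apply: lerXn2r; rewrite ?nnegrE ?mulr_ge0 ?invr_ge0 ?sqr_ge0 // ?(ltW dp) //.
  have -> : 150 * d%:R ^+ 2 / delta = 50 * (3 * (d%:R ^+ 2 / delta)) by ring.
  by rewrite ler_pM2l.
have P50 : 0 < (50 * M0%:R) ^+ d :> R by rewrite exprn_gt0 // mulr_gt0.
have dd : 0 < delta ^+ d by rewrite exprn_gt0.
have -> : 1 / (2 * (150 * d%:R ^+ 2) ^+ d) * (delta ^+ d * q%:R) =
   q%:R / 2 / ((150 * d%:R ^+ 2) ^+ d / delta ^+ d).
  by rewrite invf_div; move: P150 => /lt0r_neq0 P; field.
rewrite ler_pM2l ?divr_gt0 //.
by rewrite lef_pV2 // posrE divr_gt0.
Qed.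

End NearPointCounts.

Theorem theorem1p1 (R : realType) (n : nat) (f : 'I_n -> R -> R) (U : set R)
  (hn : (3 <= n)%N) (hU : open U) (hsub : `[(-2)%R, 2%R] `<=` U)
  (hsmooth : forall (i : 'I_n) (k : nat) (x : R), U x ->
      derivable (derive1n k (f i)) x 1)
  (hdet : forall t : R, U t -> \det (wronski f t) != 0)
  (nu : R) (hnu : 0 < nu) :
  (exists C : R, 0 < C /\
     forall (q : nat) (delta : R), (0 < q)%N -> 0 < delta < 1 / 4 ->
       (NM f q delta)%:R <= C * (delta ^+ (n - 1) * q%:R + q%:R `^ (Theta R n + nu)))
  /\
  (exists (q0 : nat) (c : R), 0 < c /\
     forall (q : nat) (delta : R), (0 < q)%N -> (q0 <= q)%N -> 0 < delta < 1 / 4 ->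
       q%:R `^ (- lower_exp R n + nu) <= delta ->
       c * (delta ^+ (n - 1) * q%:R) <= (NM f q delta)%:R).
Proof.
case: n f hn hsmooth hdet => [//|d] f hn hsmooth hdet.
have d_gt0 : (0 < d)%N by move: hn; clear; lia.
rewrite subn1 /= (lower_expE R hn) (ThetaE R hn) (lower_expE R hn) subn1 /=.
have [B [C0 [B0 C00 Fder Fbnd Fnd]]] := nondegenerate_bounds d_gt0 hsub hsmooth hdet.
have fd (i : 'I_d) (y : R) y2 := Fder i 0%N y y2.
have fb (i : 'I_d) (y : R) y2 := Fbnd i 1%N y isT y2.
set D := critical_degree d.+1.
have D_gt0 : (0 < D)%N by exact: critical_degree_gt0.
(* [tent_count] needs the row sums to be at most N/10 with N = 2q + 1, and q/5 is below this. *)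
have fifth : 0 < 1 / 5 :> R by rewrite divr_gt0.
have [e0 e0p He] := frequency_sum_le (F := fun i k => derive1n k (f (lift ord0 i)))
  d_gt0 B0 C00 Fder Fbnd Fnd (fun p pd => mul_le_critical_degree pd) fifth.
rewrite -/D in He.
(* Capping at 1 gives [eps <= eps ^ (1/D)], by which the upper bound takes [eps] out of the root. *)
pose eps : R := Num.min e0 1.
have ep : 0 < eps by rewrite /eps lt_min e0p ltr01.
have e1 : eps <= 1 by rewrite /eps ge_min lexx orbT.
have ee0 : eps <= e0 by rewrite /eps ge_min lexx.
clearbody eps.
have off q L (k : {ffun 'I_d -> 'I_L}) : (0 < q)%N -> (0 < L)%N -> L%:R ^+ D <= eps * q%:R ->
  \sum_(l | l != k) `|\sum_(0 <= a < (2 * q).+1)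
     cos (pairing k (lifted_curve f q a) - pairing l (lifted_curve f q a))| <= 1 / 5 * q%:R.
  move=> q0 L0 LD; have := He q L k q0 L0.
  have LD' : L%:R ^+ D <= e0 * q%:R by apply: (le_trans LD); rewrite ler_pM2r // ltr0n.
  move=> /(_ LD'); apply: le_trans; rewrite le_eqVlt; apply/orP; left; apply/eqP.
  apply: eq_bigr => l _; congr (`| _ |); apply: eq_bigr => a _; congr cos.
  rewrite /pairing -mulrBr -sumrB; congr (_ * _); rewrite mulr_sumr.
  by apply: eq_bigr => i _; rewrite /lifted_curve /=; ring.
have eb : 0 < eps <= 1 by rewrite ep.
split; last exact: (near_set_lower_bound d_gt0 D_gt0 eb fd fb off hnu).
apply: (near_set_upper_bound d_gt0 D_gt0 eb fd fb off hnu).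
have := mul_le_critical_degree d_gt0; rewrite -/D subn0; move: d_gt0; clear; lia.
Qed.
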